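(* Every stringent skew hyperfield is (isomorphic to) a quotient $K/U$ of a skew field $K$ by some normal subgroup $U$ of $K^\times$.
   Context: A hyperoperation on a set $S$ is a map $\boxplus$ from $S\times S$ to the nonempty subsets of $S$; for nonempty $A,B\subseteq S$ put $A\boxplus B=\bigcup_{a\in A,b\in B}a\boxplus b$; $\boxplus$ is associative if $a\boxplus(b\boxplus c)=(a\boxplus b)\boxplus c$ for all $a,b,c$. A hypergroup is $(G,\boxplus,0)$ with $\boxplus$ an associative hyperoperation such that: $0\boxplus x=x\boxplus 0=\{x\}$ for all $x$; for every $x$ there is a unique $x'$ with $0\in x\boxplus x'$ and a unique $x''$ with $0\in x''\boxplus x$, and $x'=x''$, denoted $-x$; and $x\in y\boxplus z$ if and only if $-x\in -z\boxplus -y$. It is commutative if $y\boxplus z=z\boxplus y$ for all $y,z$. A skew hyperring is $(R,\odot,\boxplus,1,0)$ with $(R,\odot,1)$ a monoid, $(R,\boxplus,0)$ a commutative hypergroup, $x\odot 0=0\odot x=0$, and $a\odot(x\boxplus y)=(a\odot x)\boxplus(a\odot y)$, $(x\boxplus y)\odot a=(x\odot a)\boxplus(y\odot a)$. A skew hyperfield is a skew hyperring with $0\ne1$ in which every nonzero element has a multiplicative inverse. It is stringent if $a\boxplus b$ is a singleton whenever $a\ne-b$. For a skew field $K$ and a normal subgroup $U$ of $K^\times$, the quotient $K/U$ is the skew hyperfield with ground set $\{[g]=gU\mid g\in K\}$, multiplication $[g]\cdot[h]=[gh]$, and hyperaddition $[g]\boxplus[0]=[0]\boxplus[g]=\{[g]\}$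 and $[g]\boxplus[h]=\{[f]\mid f\in gU+hU\}$ for nonzero $[g],[h]$. Isomorphisms of skew hyperfields are bijections preserving $0$, $1$, multiplication and hyperaddition. *)

(* Defs.v *)
From mathcomp Require Import all_boot all_algebra.
From mathcomp Require Import boolp classical_sets.

Set Implicit Arguments.
Unset Strict Implicit.
Unset Printing Implicit Defensive.

Import GRing.Theory.
Local Open Scope classical_set_scope.
Local Open Scope ring_scope.

Definition hadd_set (G : Type) (hadd : G -> G -> set G) (A B : set G) : set G :=
  \bigcup_(a in A) \bigcup_(b in B) hadd a b.

(* The inverse map is carried as data; [hypergroup_oppr] and [hypergroup_oppl]
   determine it uniquely: [unique P y] says that [y] is the only element with
   property [P]. *)
Record is_hypergroup (G : Type) (hadd : G -> G -> set G) (hzero : G)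
    (hopp : G -> G) : Prop := IsHypergroup {
  hypergroup_nonempty : forall x y, hadd x y !=set0;
  hypergroup_assoc : forall a b c,
    hadd_set hadd [set a] (hadd b c) = hadd_set hadd (hadd a b) [set c];
  hypergroup_add0l : forall x, hadd hzero x = [set x];
  hypergroup_add0r : forall x, hadd x hzero = [set x];
  hypergroup_oppr : forall x, unique (fun y => hadd x y hzero) (hopp x);
  hypergroup_oppl : forall x, unique (fun y => hadd y x hzero) (hopp x);
  hypergroup_rev : forall x y z,
    hadd y z x <-> hadd (hopp z) (hopp y) (hopp x) }.

Record is_skew_hyperring (R : Type) (hmul : R -> R -> R)
    (hadd : R -> R -> set R) (hone hzero : R) (hopp : R -> R) : Prop :=
  IsSkewHyperring {
  hyperring_mulA : associative hmul;
  hyperring_mul1l : left_id hone hmul;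
  hyperring_mul1r : right_id hone hmul;
  hyperring_hypergroup : is_hypergroup hadd hzero hopp;
  hyperring_addC : commutative hadd;
  hyperring_mul0l : left_zero hzero hmul;
  hyperring_mul0r : right_zero hzero hmul;
  hyperring_distl : forall a x y,
    [set hmul a z | z in hadd x y] = hadd (hmul a x) (hmul a y);
  hyperring_distr : forall a x y,
    [set hmul z a | z in hadd x y] = hadd (hmul x a) (hmul y a) }.

Record is_skew_hyperfield (R : Type) (hmul : R -> R -> R)
    (hadd : R -> R -> set R) (hone hzero : R) (hopp : R -> R) : Prop :=
  IsSkewHyperfield {
  hyperfield_hyperring : is_skew_hyperring hmul hadd hone hzero hopp;
  hyperfield_zero_neq_one : hzero <> hone;
  hyperfield_inv : forall x, x <> hzero ->
    exists y, hmul x y = hone /\ hmul y x = hone }.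

Record skewHyperfield := SkewHyperfield {
  hsort :> Type;
  hmul : hsort -> hsort -> hsort;
  hadd : hsort -> hsort -> set hsort;
  hone : hsort;
  hzero : hsort;
  hopp : hsort -> hsort;
  hyperfieldP : is_skew_hyperfield hmul hadd hone hzero hopp }.

Arguments hone : clear implicits.
Arguments hzero : clear implicits.

Definition stringent (F : skewHyperfield) : Prop :=
  forall a b : F, a <> hopp b -> exists c, hadd a b = [set c].

Record is_hyperfield_iso (F1 F2 : skewHyperfield) (f : F1 -> F2) : Prop :=
  IsHyperfieldIso {
  iso_bij : bijective f;
  iso_zero : f (hzero F1) = hzero F2;
  iso_one : f (hone F1) = hone F2;
  iso_mul : forall x y, f (hmul x y) = hmul (f x) (f y);
  iso_add : forall x y, f @` hadd x y = hadd (f x) (f y) }.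

Definition isomorphic (F1 F2 : skewHyperfield) : Prop :=
  exists f : F1 -> F2, is_hyperfield_iso f.

(* The axiom of [fieldType], but over a possibly noncommutative ring; [1 != 0]
   is part of [unitRingType]. *)
Definition is_skew_field (K : unitRingType) : Prop := GRing.field_axiom K.

Record is_normal_unit_subgroup (K : unitRingType) (U : set K) : Prop :=
  IsNormalUnitSubgroup {
  normal_unit : forall u, U u -> u \is a GRing.unit;
  normal_one : U 1;
  normal_mul : forall u v, U u -> U v -> U (u * v);
  normal_inv : forall u, U u -> U u^-1;
  normal_conj : forall g u, g \is a GRing.unit -> U u -> U (g * u * g^-1) }.

Section Quotient.
Variables (K : unitRingType) (U : set K).

Definition lcoset (g : K) : set K := [set g * u | u in U].

Definition quotient : Type := {A : set K | exists g, A = lcoset g}.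

Definition qclass (g : K) : quotient :=
  exist _ (lcoset g) (ex_intro _ g erefl).

Definition qrepr (A : quotient) : K := projT1 (cid (proj2_sig A)).

(* Multiplication and negation go through representatives; [qmulE] and [qoppE]
   below show that they do not depend on the choice. *)
Definition qmul (A B : quotient) : quotient := qclass (qrepr A * qrepr B).
Definition qopp (A : quotient) : quotient := qclass (- qrepr A).

Definition qadd (A B : quotient) : set quotient :=
  if `[< A = qclass 0 >] then [set B]
  else if `[< B = qclass 0 >] then [set A]
  else [set qclass (x + y) | x in sval A & y in sval B].

Hypotheses (HK : is_skew_field K) (HU : is_normal_unit_subgroup U).

Let U1 := normal_one HU.
Let UM := normal_mul HU.
Let UV := normal_inv HU.
Let Uu := normal_unit HU.

Lemma qclass_inj_val (A B : quotient) : sval A = sval B -> A = B.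
Proof.
by case: A B => [A hA] [B hB] /= AB; subst B; congr exist; exact: Prop_irrelevance.
Qed.

Lemma qreprK (A : quotient) : qclass (qrepr A) = A.
Proof. by apply: qclass_inj_val; rewrite /= /qrepr; case: cid. Qed.

Lemma qclassP (a b : K) : qclass a = qclass b <-> exists2 u, U u & a = b * u.
Proof.
split=> [/(congr1 sval)/= ab|[u Uu0 ->]].
  have : lcoset a a by exists 1; rewrite ?mulr1.
  by rewrite ab => -[u Uu0 <-]; exists u.
apply: qclass_inj_val; rewrite /=; apply/seteqP; split=> _ [v Uv <-].
  by exists (u * v); [exact: UM | rewrite mulrA].
exists (u^-1 * v); first by apply: UM => //; exact: UV.
by rewrite mulrA mulrK //; exact: Uu.
Qed.

Lemma qclass_mulr (a u : K) : U u -> qclass (a * u) = qclass a.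
Proof. by move=> Uu0; apply/qclassP; exists u. Qed.

Lemma Uswap (u g : K) : U u -> exists2 v, U v & u * g = g * v.
Proof.
move=> Uu0; have [->|g0] := eqVneq g 0; first by exists 1; rewrite ?mulr0 ?mul0r.
have gu := HK g0; exists (g^-1 * u * g); last by rewrite !mulrA divrr // mul1r.
by rewrite -[X in _ * X]invrK; apply: normal_conj => //; rewrite unitrV.
Qed.

Lemma qclass0P (a : K) : qclass a = qclass 0 -> a = 0.
Proof. by move=> /qclassP[u _ ->]; rewrite mul0r. Qed.

Lemma qmulE (a b : K) : qmul (qclass a) (qclass b) = qclass (a * b).
Proof.
rewrite /qmul; have /qclassP[u Uu0 ->] := qreprK (qclass a).
have /qclassP[v Uv ->] := qreprK (qclass b).
rewrite mulrA qclass_mulr // -mulrA; have [w Uw ->] := Uswap b Uu0.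
by rewrite mulrA qclass_mulr.
Qed.

Lemma qoppE (a : K) : qopp (qclass a) = qclass (- a).
Proof.
by rewrite /qopp; have /qclassP[u Uu0 ->] := qreprK (qclass a);
  rewrite -mulNr qclass_mulr.
Qed.

Lemma qaddE (a b c : K) : qadd (qclass a) (qclass b) (qclass c) <->
  exists u v, [/\ U u, U v & c = a * u + b * v].
Proof.
rewrite /qadd; case: asboolP => [/qclass0P ->|_].
  split=> [/qclassP[v Uv ->]|[u [v [_ Uv ->]]]].
    by exists 1, v; rewrite mul0r add0r.
  by rewrite mul0r add0r /= qclass_mulr.
case: asboolP => [/qclass0P ->|_].
  split=> [/qclassP[v Uv ->]|[u [v [Uu0 Uv ->]]]].
    by exists v, 1; rewrite mul0r addr0.
  by rewrite mul0r addr0 /= qclass_mulr.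
split=> [[_ [u Uu0 <-] [_ [v Uv <-]]]|[u [v [Uu0 Uv ->]]]].
  move=> /esym/qclassP[w Uw ->]; exists (u * w), (v * w).
  by rewrite mulrDl !mulrA; split=> //; exact: UM.
by exists (a * u); [exists u | exists (b * v); [exists v|]].
Qed.

Lemma quotient_hypergroup : is_hypergroup qadd (qclass 0) qopp.
Proof.
have opp_uniq a b : qadd (qclass a) (qclass b) (qclass 0) <->
    qclass (- a) = qclass b.
  rewrite qaddE qclassP; split=> [[u [v [Uu0 Uv]]]|[u Uu0 /esym E]].
    move=> /esym/eqP; rewrite addr_eq0 => /eqP E.
    exists (v * u^-1); first by apply: UM => //; exact: UV.
    rewrite mulrA; apply: (canRL (mulrK (Uu Uu0))).
    by rewrite mulNr E opprK.
  by exists 1, u; rewrite mulr1 E subrr.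
have addC A B : qadd A B = qadd B A.
  rewrite -(qreprK A) -(qreprK B); apply/seteqP.
  by split=> C; rewrite -(qreprK C) !qaddE => -[u [v [? ? ->]]];
    exists v, u; rewrite addrC.
have oppr x : unique (fun y => qadd x y (qclass 0)) (qopp x).
  rewrite -(qreprK x) qoppE; split; first exact/opp_uniq.
  by move=> y; rewrite -(qreprK y) opp_uniq.
split.
- move=> x y; rewrite -(qreprK x) -(qreprK y).
  exists (qclass (qrepr x + qrepr y)); apply/qaddE.
  by exists 1, 1; rewrite !mulr1.
- move=> A B C; rewrite -(qreprK A) -(qreprK B) -(qreprK C).
  move: (qrepr A) (qrepr B) (qrepr C) => a b c {A B C}.
  apply/seteqP; split=> D; rewrite -(qreprK D); move: (qrepr D) => d {D}.
    move=> [_ -> [E]]; rewrite -(qreprK E); move: (qrepr E) => e {E}.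
    move=> /qaddE[u [v [Uu0 Uv ->]]] /qaddE[s [t [Us Ut ->]]].
    exists (qclass (a * s + b * (u * t))).
      by apply/qaddE; exists s, (u * t); split=> //; exact: UM.
    exists (qclass c) => //; apply/qaddE; exists 1, (v * t).
    by rewrite mulr1 mulrDl !mulrA addrA; split=> //; exact: UM.
  move=> [E]; rewrite -(qreprK E); move: (qrepr E) => e {E}.
  move=> /qaddE[u [v [Uu0 Uv ->]]] [_ ->] /qaddE[s [t [Us Ut ->]]].
  exists (qclass a) => //.
  exists (qclass (b * (v * s) + c * t)).
    by apply/qaddE; exists (v * s), t; split=> //; exact: UM.
  apply/qaddE; exists (u * s), 1.
  by rewrite mulr1 mulrDl !mulrA addrA; split=> //; exact: UM.
- by move=> x; rewrite /qadd; case: asboolP.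
- by move=> x; rewrite /qadd; case: asboolP => [->|_] //; case: asboolP.
- exact: oppr.
- by move=> x; have [p q] := oppr x; split=> [|y]; rewrite addC //; exact: q.
- move=> x y z; rewrite -(qreprK x) -(qreprK y) -(qreprK z) !qoppE !qaddE.
  split=> -[u [v [Uu0 Uv E]]]; exists v, u; split=> //.
    by rewrite E opprD !mulNr addrC.
  by rewrite -[LHS]opprK E opprD !mulNr !opprK addrC.
Qed.

Lemma quotient_hyperfield :
  is_skew_hyperfield qmul qadd (qclass 1) (qclass 0) qopp.
Proof.
split; last 2 first.
- by move=> /esym/qclass0P/eqP; rewrite oner_eq0.
- move=> x; rewrite -(qreprK x) => x0.
  have xu : qrepr x \is a GRing.unit.
    by apply: HK; apply/eqP => E; apply: x0; rewrite E.
  by exists (qclass (qrepr x)^-1); rewrite !qmulE divrr // mulVr.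
split.
- by move=> x y z; rewrite -(qreprK x) -(qreprK y) -(qreprK z) !qmulE mulrA.
- by move=> x; rewrite -(qreprK x) qmulE mul1r.
- by move=> x; rewrite -(qreprK x) qmulE mulr1.
- exact: quotient_hypergroup.
- move=> A B; rewrite -(qreprK A) -(qreprK B); apply/seteqP.
  by split=> C; rewrite -(qreprK C) !qaddE => -[u [v [? ? ->]]];
    exists v, u; rewrite addrC.
- by move=> x; rewrite -(qreprK x) qmulE mul0r.
- by move=> x; rewrite -(qreprK x) qmulE mulr0.
- move=> A X Y; rewrite -(qreprK A) -(qreprK X) -(qreprK Y).
  move: (qrepr A) (qrepr X) (qrepr Y) => a x y {A X Y}.
  rewrite !qmulE; apply/seteqP; split=> D.
    move=> [Z]; rewrite -(qreprK Z) => /qaddE[u [v [Uu0 Uv ->]]] <-.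
    by rewrite qmulE; apply/qaddE; exists u, v; rewrite mulrDr !mulrA.
  rewrite -(qreprK D) => /qaddE[u [v [Uu0 Uv ->]]].
  exists (qclass (x * u + y * v)); first by apply/qaddE; exists u, v.
  by rewrite qmulE mulrDr !mulrA.
- move=> A X Y; rewrite -(qreprK A) -(qreprK X) -(qreprK Y).
  move: (qrepr A) (qrepr X) (qrepr Y) => a x y {A X Y}.
  have [->|a0] := eqVneq a 0.
    rewrite !qmulE !mulr0; apply/seteqP; split=> D.
      by move=> [Z _ <-]; rewrite -(qreprK Z) qmulE mulr0; apply/qaddE;
         exists 1, 1; rewrite !mulr1 addr0.
    rewrite -(qreprK D) => /qaddE[u [v [_ _ ->]]].
    exists (qclass (x + y)); last by rewrite qmulE mulr0 !mul0r addr0.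
    by apply/qaddE; exists 1, 1; rewrite !mulr1.
  have au := HK a0.
  rewrite !qmulE; apply/seteqP; split=> D.
    move=> [Z]; rewrite -(qreprK Z) => /qaddE[u [v [Uu0 Uv ->]]] <-.
    have [u' Uu' Eu] := Uswap a Uu0; have [v' Uv' Ev] := Uswap a Uv.
    rewrite qmulE; apply/qaddE; exists u', v'.
    by rewrite mulrDl -!mulrA Eu Ev.
  rewrite -(qreprK D) => /qaddE[u [v [Uu0 Uv ->]]].
  exists (qclass (x * (a * u * a^-1) + y * (a * v * a^-1))).
    apply/qaddE; exists (a * u * a^-1), (a * v * a^-1).
    by split=> //; exact: (normal_conj HU).
  by rewrite qmulE mulrDl -!mulrA mulVr // !mulr1.
Qed.

Definition quotient_skewHyperfield : skewHyperfield :=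
  SkewHyperfield quotient_hyperfield.

End Quotient.

(* Main.v *)
Require Import Defs.
From HB Require Import structures.
From mathcomp Require Import all_boot all_order all_algebra.
From mathcomp Require Import boolp classical_sets functions cardinality fsbigop.

(* Call c negligible when it lies in 1 - 1 but is not 1 or -1. In a stringent
   skew hyperfield F the negligible elements are the positive cone of a total
   preorder on F^* whose indifference class N of 1 is a normal subgroup. If 1 is
   not in 1 - 1, then N with 0 is a skew field; otherwise N = {1, -1}, which maps
   to the sign group of the rationals. Either way F^* acts on a skew field of
   coefficients, and the twisted Hahn series with exponents in F^*/N form a skew
   field K. Sending a series to its leading term is a multiplicative map from K
   onto F, the hypersum of two leading terms is the set of leading terms of sums,
   and so F is K modulo the series with leading term 1. *)

Set Implicit Arguments.
Unset Strict Implicit.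
Unset Printing Implicit Defensive.

Import Order.TTheory GRing.Theory Num.Theory.
Local Open Scope classical_set_scope.
Local Open Scope ring_scope.

(** * Preordered groups *)

(** Stringency confines multivaluedness to the sums x - x. Leading terms of series behave in the
    same way: only when they cancel does the leading term of the sum remain undetermined, and it can
    then be anything smaller. The order is oriented accordingly: [hlt h k] means that [k] is
    negligible against [h], so leading exponents are minima and supports are well-ordered. If 1 lies
    in 1 - 1, then N with 0 is the sign hyperfield (the Krasner hyperfield if 1 = -1) and not a
    field, so coefficients must come from outside; the rationals serve because positive numbers are
    closed under addition. F^* need not split as an extension of F^*/N by N, so exponents cannot be
    realized as a subgroup of F^*. Inverses avoid the geometric series, which would need the union
    of all powers of a support to be well-ordered; products of two well-ordered sets suffice. *)

(* The comparison [a < b] is [cpos (a^-1 * b)]; it is a total preorder whose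
   indifference classes are the cosets of the normal subgroup [ker] below. *)
Record preordered_group := PreorderedGroup {
  cgrp : groupType;
  cpos : set cgrp;
  cpos_asym : forall a, cpos a -> ~ cpos a^-1%g;
  cposJ : forall a b, cpos a -> cpos (b * a * b^-1)%g;
  cpos_mull : forall a b, ~ cpos b^-1%g -> cpos a -> cpos (b * a)%g }.

Section Order.
Variable D : preordered_group.
Local Notation H := (cgrp D).
Local Notation pos := (@cpos D).
Implicit Types (a b c h k m n : H) (A B C : set H).

Definition ker : set H := [set n | ~ pos n /\ ~ pos n^-1%g].
Definition hlt h k := pos (h^-1 * k)%g.
Definition heqv h k := ker (h^-1 * k)%g.

Lemma pos1 : ~ pos 1%g.
Proof. by move=> p1; apply: (cpos_asym p1); rewrite invg1. Qed.

Lemma posM a b : pos a -> pos b -> pos (a * b)%g.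
Proof. by move=> pa; apply: cpos_mull; exact: cpos_asym. Qed.

Lemma pos_mulr a b : ~ pos b^-1%g -> pos a -> pos (a * b)%g.
Proof.
move=> nb pa; have -> : (a * b = b * (b^-1 * a * b^-1^-1))%g.
  by rewrite invgK !mulgA mulgV mul1g.
by apply: cpos_mull => //; exact: cposJ.
Qed.

Lemma ker1 : ker 1%g.
Proof. by split; rewrite ?invg1; exact: pos1. Qed.

Lemma kerV n : ker n -> ker n^-1%g.
Proof. by move=> [? ?]; split=> //; rewrite invgK. Qed.

Lemma kerM m n : ker m -> ker n -> ker (m * n)%g.
Proof.
have np a b : ker a -> ker b -> ~ pos (a * b)%g.
  move=> [pa na] [pb nb] pab; apply: pb; rewrite -(mulKg a b).
  by apply: cpos_mull => //; rewrite invgK.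
move=> km kn; split; first exact: np.
by rewrite invgM; apply: np; exact: kerV.
Qed.

Lemma kerJ a n : ker n -> ker (a * n * a^-1)%g.
Proof.
have np b : ~ pos b -> ~ pos (a * b * a^-1)%g.
  by move=> nb /(cposJ a^-1%g); rewrite !mulgA mulVg mul1g mulgK.
by move=> [? ?]; split; rewrite ?invgM ?invgK ?mulgA; exact: np.
Qed.

Lemma kerJV a n : ker n -> ker (a^-1 * n * a)%g.
Proof. by move=> /(kerJ a^-1%g); rewrite invgK. Qed.

Lemma hlt_irr a : ~ hlt a a.
Proof. by rewrite /hlt mulVg; exact: pos1. Qed.

Lemma hlt_trans b a c : hlt a b -> hlt b c -> hlt a c.
Proof. by move=> ab bc; have := posM ab bc; rewrite /hlt !mulgA mulgK. Qed.

Lemma hle_lt_trans b a c : ~ hlt b a -> hlt b c -> hlt a c.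
Proof.
rewrite /hlt => ba bc; have -> : (a^-1 * c = a^-1 * b * (b^-1 * c))%g.
  by rewrite !mulgA mulgK.
by apply: cpos_mull; rewrite // invgM invgK.
Qed.

Lemma hlt_le_trans b a c : hlt a b -> ~ hlt c b -> hlt a c.
Proof.
rewrite /hlt => ab cb; have -> : (a^-1 * c = a^-1 * b * (b^-1 * c))%g.
  by rewrite !mulgA mulgK.
by apply: pos_mulr; rewrite // invgM invgK.
Qed.

Lemma hle_trans b a c : ~ hlt b a -> ~ hlt c b -> ~ hlt c a.
Proof. by move=> ba cb ca; apply: cb; exact: hlt_le_trans ca ba. Qed.

Lemma hlt_mull c a b : hlt (c * a)%g (c * b)%g = hlt a b.
Proof. by rewrite /hlt invgM -mulgA mulKg. Qed.

Lemma hlt_mulr c a b : hlt (a * c)%g (b * c)%g <-> hlt a b.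
Proof.
have h e u v : hlt u v -> hlt (u * e)%g (v * e)%g.
  by move=> /(cposJ e^-1%g); rewrite /hlt invgM invgK !mulgA.
by split=> [/(h c^-1%g)|]; [rewrite !mulgK | exact: h].
Qed.

Lemma heqvP a b : heqv a b <-> ~ hlt a b /\ ~ hlt b a.
Proof. by rewrite /heqv /ker /= invgM invgK. Qed.

Lemma heqv_sym a b : heqv a b -> heqv b a.
Proof. by rewrite !heqvP => -[]. Qed.

Lemma heqv_refl a : heqv a a.
Proof. by rewrite /heqv mulVg; exact: ker1. Qed.

Lemma heqv_trans b a c : heqv a b -> heqv b c -> heqv a c.
Proof.
by rewrite /heqv => ab bc; have := kerM ab bc; rewrite !mulgA mulgK.
Qed.

Lemma heqv_ker a b : heqv a b <-> ker (b * a^-1)%g.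
Proof.
split=> [/(kerJ a)|/(kerJV a)]; first by rewrite mulgA mulgV mul1g.
by rewrite mulgA mulgVK.
Qed.

Lemma heqv_mull c a b : heqv (c * a)%g (c * b)%g = heqv a b.
Proof. by rewrite /heqv invgM -mulgA mulKg. Qed.

Lemma heqv_kerl n h : ker n -> heqv h (n * h)%g.
Proof. by move=> kn; apply/heqv_ker; rewrite mulgK. Qed.

(** [xget] sees only the predicate [heqv h], which is the same for indifferent elements; hence they
    share their representative. *)
Definition rep h : H := xget 1%g (heqv h).

Definition trans : set H := [set a | rep a = a].

Lemma heqv_rep h : heqv h (rep h).
Proof. by rewrite /rep; apply: xgetPex; exists h; exact: heqv_refl. Qed.

Lemma rep_eqv h k : heqv h k -> rep h = rep k.
Proof.
move=> hk; rewrite /rep; congr xget; apply/seteqP; split=> a /=.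
  by apply: heqv_trans; exact: heqv_sym.
exact: heqv_trans.
Qed.

Lemma trans_rep h : trans (rep h).
Proof. by apply/esym/rep_eqv/heqv_rep. Qed.

Lemma trans_eqv a b : trans a -> trans b -> heqv a b -> a = b.
Proof. by move=> ta tb ab; rewrite -ta -tb; exact: rep_eqv. Qed.

(** * Well-ordered subsets *)

Definition hmin A m := A m /\ forall a, A a -> ~ hlt a m.

Definition hwo A := forall B, B `<=` A -> B !=set0 -> exists m, hmin B m.

Lemma hwoS A B : A `<=` B -> hwo B -> hwo A.
Proof. by move=> AB wB C CA; apply: wB; exact: subset_trans AB. Qed.

Lemma hwoU A B : hwo A -> hwo B -> hwo (A `|` B).
Proof.
move=> wA wB C CAB [c Cc].
have [CA0|/set0P CA0] := eqVneq (C `&` A) set0.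
  apply: wB; last by exists c.
  move=> x Cx; have [Ax|//] := CAB _ Cx.
  by have : (C `&` A) x by []; rewrite CA0.
have [a [[Ca Aa] ma]] := wA (C `&` A) (@subIsetr _ _ _) CA0.
have [CB0|/set0P CB0] := eqVneq (C `&` B `&` [set b | hlt b a]) set0.
  exists a; split=> // x Cx xa; have [Ax|Bx] := CAB _ Cx; first exact: ma xa.
  by have : (C `&` B `&` [set b | hlt b a]) x by []; rewrite CB0.
have [|b [[[Cb Bb] /= ba] mb]] := wB _ _ CB0; first by move=> x [[]].
exists b; split=> // x Cx xb; have [Ax|Bx] := CAB _ Cx.
  by apply: (ma x) => //; exact: hlt_trans ba.
by apply: (mb x) => //; split=> //=; exact: hlt_trans ba.
Qed.

(* In a putative nonempty set [C] of products without minimum, choose [b]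
   minimal among the right factors whose left factor is minimal over the
   products below; passing to a smaller product keeps the left factor at least
   as large and hence strictly decreases [b]. *)
Lemma hwo_mul A B : hwo A -> hwo B ->
  hwo [set c | exists a b, [/\ A a, B b & c = (a * b)%g]].
Proof.
move=> wA wB C CAB [c0 Cc0]; apply: contrapT => nomin.
have low c : C c -> exists2 c', C c' & hlt c' c.
  move=> Cc; apply: contrapT => nc; apply: nomin; exists c; split=> // a Ca ac.
  by apply: nc; exists a.
pose below c :=
  [set a | A a /\ exists b, [/\ B b, C (a * b)%g & hlt (a * b)%g c]].
pose good a b := [/\ A a, B b & C (a * b)%g] /\
  exists2 c, hlt (a * b)%g c & hmin (below c) a.
have next c : C c -> exists a b, good a b /\ hlt (a * b)%g c.
  move=> Cc; have [|c' Cc' cc'] := low c; first by [].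
  have [a [b [Aa Bb cab]]] := CAB _ Cc'; subst c'.
  have [||a' [[Aa' [b' [Bb' Cb' lb']]] mina']] := wA (below c).
  - by move=> ? [].
  - by exists a; split=> //; exists b.
  exists a', b'; split=> //; split=> //; exists c => //; split=> //.
  by split=> //; exists b'.
have [||b [[a gab] minb]] := wB [set b | exists a, good a b].
- by move=> b [a [[]]].
- by have [a [b [gab _]]] := next _ Cc0; exists b, a.
have [[Aa Bb Cab] [c abc [_ mina]]] := gab.
have [a' [b' [gab' lt']]] := next _ Cab.
have [[Aa' Bb' Cab'] _] := gab'.
apply: (minb b'); first by exists a'.
have aa' : ~ hlt a' a.
  by apply: mina; split=> //; exists b'; split=> //; exact: hlt_trans abc.
rewrite -(hlt_mull a); apply: hle_lt_trans lt'.
by move=> /hlt_mulr.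
Qed.

Definition hcowo A := forall B, B `<=` A -> B !=set0 ->
  exists2 m, B m & forall a, B a -> ~ hlt m a.

(** Take the least [m] with infinitely many predecessors: its largest predecessor [p] has only
    finitely many, and these together with [p] are all predecessors of [m]. Inside [trans] the
    preorder is antisymmetric. *)
Lemma finite_wo_cowo A : A `<=` trans -> hwo A -> hcowo A -> finite_set A.
Proof.
move=> AT wA cA; pose dn a := A `&` [set b | hlt b a].
have eqA a b : A a -> A b -> ~ hlt a b -> ~ hlt b a -> a = b.
  by move=> Aa Ab ab ba; apply: trans_eqv; [exact: AT| exact: AT| apply/heqvP].
have step B m : B `<=` A -> B m -> (forall a, B a -> ~ hlt m a) ->
    finite_set (dn m) -> finite_set B.
  move=> BA Bm mB fm; apply: (@sub_finite_set _ _ (dn m `|` [set m])).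
    move=> x Bx; have [xm|xm] := pselect (hlt x m); [left|right].
      by split=> //; exact: BA.
    by apply: eqA => //; [exact: BA|exact: BA|exact: mB].
  by rewrite finite_setU; split=> //; exact: finite_set1.
have fdn a : A a -> finite_set (dn a).
  move=> Aa; apply: contrapT => nfa.
  have [||m [[Am nfm] mm]] := wA [set b | A b /\ ~ finite_set (dn b)].
  - by move=> ? [].
  - by exists a.
  have [d0|/set0P d0] := eqVneq (dn m) set0; first by apply: nfm; rewrite d0.
  have [|p [Ap pm] maxp] := cA (dn m) _ d0; first by move=> ? [].
  apply: nfm; apply: (step _ p) => //; first by move=> ? [].
  by apply: contrapT => nfp; exact: (mm p).
have [->//|/set0P A0] := eqVneq A set0.
by have [//|p Ap maxp] := cA A _ A0; apply: (step _ p) => //; exact: fdn.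
Qed.

(** For a fixed product [h], a larger left factor [a] forces a smaller right factor [a^-1 * h], so
    the least right factor yields a largest left factor. This makes convolution a finite sum. *)
Lemma finite_fiber A B h : hwo A -> hwo B ->
  finite_set [set a | [/\ trans a, A a & B (a^-1 * h)%g]].
Proof.
move=> wA wB; apply: finite_wo_cowo.
- by move=> a [].
- by apply: hwoS wA => a [].
move=> C CA [c Cc].
have [||m [[a Ca <-] mm]] := wB [set (a^-1 * h)%g | a in C].
- by move=> _ [a /CA[_ _ ?] <-].
- by exists (c^-1 * h)%g, c.
exists a => // b Cb ab; apply: (mm (b^-1 * h)%g); first by exists b.
apply/hlt_mulr; rewrite /hlt invgK.
by have := cposJ b ab; rewrite !mulgA mulgK.
Qed.

End Order.

(** * Convolution of well-supported functions *)

(* Data for a crossed product of the skew field [cring] with the group modulo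
   [ker]: instead of choosing a section and a cocycle, [ker] is mapped to the
   units of [cring] by [ciota], compatibly with the action. *)
Record crossed_system := CrossedSystem {
  cord :> preordered_group;
  cring : unitRingType;
  cact : cgrp cord -> cring -> cring;
  ciota : cgrp cord -> cring;
  cring_field : GRing.field_axiom cring;
  cactD : forall a p q, cact a (p + q) = cact a p + cact a q;
  cactM : forall a p q, cact a (p * q) = cact a p * cact a q;
  cact1 : forall a, cact a 1 = 1;
  cact_mul : forall a b p, cact (a * b)%g p = cact a (cact b p);
  cact_one : forall p, cact 1%g p = p;
  ciota1 : ciota 1%g = 1;
  ciotaM : forall m n, ker m -> ker n -> ciota (m * n)%g = ciota m * ciota n;
  cact_iota : forall a n, ker n -> cact a (ciota n) = ciota (a * n * a^-1)%g;
  ciota_act : forall n p, ker n -> cact n p = ciota n * p * (ciota n)^-1 }.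

Section Convolution.
Variable D : crossed_system.
Local Notation H := (cgrp D).
Local Notation C := (cring D).
Local Notation act := (@cact D).
Local Notation iota := (@ciota D).
Local Notation T := (@trans D).
Implicit Types (a b c h k m n : H) (p q : C) (x y z : H -> C).

Lemma act0 a : act a 0 = 0.
Proof. by apply: (addrI (act a 0)); rewrite -cactD !addr0. Qed.

Lemma actK a : cancel (act a) (act a^-1%g).
Proof. by move=> p; rewrite -cact_mul mulVg cact_one. Qed.

Lemma act_eq0 a p : (act a p == 0) = (p == 0).
Proof. by rewrite -[in LHS](act0 a) (can_eq (actK a)). Qed.

Lemma actV a p : act a p^-1 = (act a p)^-1.
Proof.
have [->|p0] := eqVneq p 0; first by rewrite invr0 act0 invr0.
have pu := cring_field p0.
have au : act a p \is a GRing.unit by apply: cring_field; rewrite act_eq0.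
by apply: (mulrI au); rewrite -cactM !divrr // cact1.
Qed.

Lemma act_fsum a (X : set H) (f : H -> C) : finite_set X ->
  act a (\sum_(i \in X) f i) = \sum_(i \in X) act a (f i).
Proof.
move=> fX; rewrite !fsbig_finite //; apply: (big_morph (act a) _ (act0 a)).
by move=> p q; exact: cactD.
Qed.

Lemma fsum_neq0 (X : set H) (f : H -> C) :
  \sum_(i \in X) f i != 0 -> exists2 i, X i & f i != 0.
Proof. exact: (@fsbigN1 _ _ _ unit _ X (fun=> f) tt). Qed.

Lemma iota_unit n : ker n -> iota n \is a GRing.unit.
Proof.
move=> kn; apply: cring_field; apply/eqP => i0.
have := ciotaM kn (kerV kn); rewrite mulgV ciota1 i0 mul0r => /eqP.
by rewrite oner_eq0.
Qed.

Lemma iotaV n : ker n -> iota n^-1%g = (iota n)^-1.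
Proof.
move=> kn; apply: (mulrI (iota_unit kn)); rewrite divrr ?iota_unit //.
by rewrite -ciotaM ?mulgV ?ciota1 //; exact: kerV.
Qed.

(* A series is a function on the whole group, determined on each coset of [ker]
   by one value; convolution therefore sums over a transversal. *)
Definition equivariant x := forall n h, ker n -> x (n * h)%g = x h * (iota n)^-1.

Definition supp x : set H := [set h | x h != 0].

Lemma equivariant_eqv0 x h k : equivariant x -> heqv h k -> x h = 0 -> x k = 0.
Proof.
by move=> ex /heqv_ker kn x0; rewrite -(mulgVK h k) ex // x0 mul0r.
Qed.

Definition term x y h a := x a * act a (y (a^-1 * h)%g).

Definition conv x y h := \sum_(a \in T) term x y h a.

(** Passing from [a] to [n * a] creates [(iota n)^-1] from [x] and, through the twisted argument of
    [y] and [ciota_act], a factor [iota n] next to it. So the choice of transversal does not affect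
    [conv]. *)
Lemma term_eqv x y h a b : equivariant x -> equivariant y -> heqv a b ->
  term x y h a = term x y h b.
Proof.
move=> ex ey /heqv_ker; set n := (b * a^-1)%g => kn.
have -> : b = (n * a)%g by rewrite /n mulgVK.
have kn' : ker (a^-1 * n^-1 * a)%g by apply: kerJV; exact: kerV.
rewrite /term ex //.
have -> : ((n * a)^-1 * h = (a^-1 * n^-1 * a) * (a^-1 * h))%g.
  by rewrite invgM !mulgA mulgK.
rewrite (ey _ (a^-1 * h)%g kn') cact_mul cactM actV; rewrite cact_iota //.
rewrite !mulgA mulgV mul1g mulgK iotaV // invrK.
rewrite (@ciota_act D n) // [iota n * (_ * _)]mulrA mulrK ?iota_unit //.
by rewrite -mulrA mulKr ?iota_unit.
Qed.

(** The freedom in [X] allows several convolutions to be summed over one common finite set. *)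
Lemma conv_eq x y h (X : set H) : X `<=` T ->
  (forall a, T a -> x a != 0 -> y (a^-1 * h)%g != 0 -> X a) ->
  conv x y h = \sum_(a \in X) term x y h a.
Proof.
move=> XT supX; apply/esym/fsbig_widen => // a [Ta nXa] /=; rewrite /term.
have [->|x0] := eqVneq (x a) 0; first by rewrite mul0r.
have [->|y0] := eqVneq (y (a^-1 * h)%g) 0; first by rewrite act0 mulr0.
by case: nXa; exact: supX.
Qed.

Definition fiber x y h := [set a | [/\ T a, x a != 0 & y (a^-1 * h)%g != 0]].

Lemma fiberT x y h : fiber x y h `<=` T. Proof. by move=> a []. Qed.

Lemma finite_fiber_supp x y h : hwo (supp x) -> hwo (supp y) ->
  finite_set (fiber x y h).
Proof. exact: finite_fiber. Qed.

Lemma conv_fiber x y h : conv x y h = \sum_(a \in fiber x y h) term x y h a.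
Proof. by apply: conv_eq; first exact: fiberT. Qed.

Lemma conv_neq0 x y h : conv x y h != 0 ->
  exists a b, [/\ x a != 0, y b != 0 & h = (a * b)%g].
Proof.
move=> /fsum_neq0[a Ta t0]; exists a, (a^-1 * h)%g; rewrite mulgA mulgV mul1g.
split=> //; apply: contra_neq t0; rewrite /term => ->; first by rewrite mul0r.
by rewrite act0 mulr0.
Qed.

Lemma conv_wo x y : hwo (supp x) -> hwo (supp y) -> hwo (supp (conv x y)).
Proof. by move=> wx wy; apply: hwoS (hwo_mul wx wy) => h /conv_neq0. Qed.

Lemma conv_equivariant x y : equivariant x -> equivariant y ->
  hwo (supp x) -> hwo (supp y) -> equivariant (conv x y).
Proof.
move=> ex ey wx wy n h kn.
rewrite (@conv_eq _ _ _ (fiber x y h)); first last.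
- move=> a Ta xa; have kn' := kerJV a kn.
  have -> : (a^-1 * (n * h) = (a^-1 * n * a) * (a^-1 * h))%g.
    by rewrite !mulgA mulgK.
  rewrite ey // => y0; split=> //; apply: contra_neq y0 => ->.
  by rewrite mul0r.
- exact: fiberT.
have fX := finite_fiber_supp h wx wy.
rewrite conv_fiber !fsbig_finite // mulr_suml; apply: eq_bigr => a _.
rewrite /term; have kn' := kerJV a kn.
have -> : (a^-1 * (n * h) = (a^-1 * n * a) * (a^-1 * h))%g.
  by rewrite !mulgA mulgK.
rewrite (ey _ (a^-1 * h)%g kn') cactM actV; rewrite cact_iota // !mulgA mulgV.
by rewrite mul1g mulgK mulrA.
Qed.

(** Translation by [b^-1] permutes the cosets of [ker] but moves [T] itself, so the bijection of [T]
    must return to representatives. *)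
Lemma trans_reindex b (f : H -> C) : (forall u v, heqv u v -> f u = f v) ->
  \sum_(c \in T) f c = \sum_(a \in T) f (b^-1 * a)%g.
Proof.
move=> fe; rewrite (@reindex_fsbig _ _ _ _ _ (fun a => rep (b^-1 * a)%g) T).
  by apply: eq_fsbigr => a _; apply/fe/heqv_sym/heqv_rep.
split.
- by move=> a _; exact: trans_rep.
- move=> u v; rewrite !inE => Tu Tv /= e; apply: trans_eqv => //.
  rewrite -(heqv_mull b^-1%g); apply: heqv_trans (heqv_rep _) _.
  by rewrite e; exact/heqv_sym/heqv_rep.
move=> c Tc; exists (rep (b * c)%g); first exact: trans_rep.
rewrite -[RHS]Tc; apply: rep_eqv; rewrite -(heqv_mull b) mulgA mulgV mul1g.
exact/heqv_sym/heqv_rep.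
Qed.

(** Both sides become one finite double sum, over the first factor [b] and the product [a] of the
    first two factors. For this the index of [conv y z] is shifted from the second factor to that
    product. *)
Lemma convA x y z :
  equivariant x -> equivariant y -> equivariant z ->
  hwo (supp x) -> hwo (supp y) -> hwo (supp z) ->
  conv x (conv y z) = conv (conv x y) z.
Proof.
move=> ex ey ez wx wy wz; apply/funext => h.
(* Asking for a product of support elements, and not for [conv x y a != 0], keeps those [a] whose
   terms cancel in [conv x y]. *)
pose X := [set a | [/\ T a, exists u v, [/\ x u != 0, y v != 0 & a = (u * v)%g]
                   & z (a^-1 * h)%g != 0]].
pose Y := \bigcup_(a in X) fiber x y a.
have fX : finite_set X by exact: (finite_fiber h (hwo_mul wx wy) wz).
have fY : finite_set Y.
  by apply: bigcup_finite => // a _; exact: finite_fiber_supp.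
have YT : Y `<=` T by move=> b [a _ []].
have fac a b : (b * (b^-1 * a))%g = a by rewrite mulgA mulgV mul1g.
have inner b : x b != 0 -> conv y z (b^-1 * h)%g =
    \sum_(a \in X) y (b^-1 * a)%g * act (b^-1 * a)%g (z (a^-1 * h)%g).
  move=> xb; rewrite /conv (@trans_reindex b); last by move=> *; exact: term_eqv.
  have tE a : term y z (b^-1 * h)%g (b^-1 * a)%g =
      y (b^-1 * a)%g * act (b^-1 * a)%g (z (a^-1 * h)%g).
    by rewrite /term invgM invgK mulgA mulgK.
  under eq_fsbigr do rewrite tE.
  apply/esym/fsbig_widen => [a []//|a [Ta nXa] /=].
  have [->|y0] := eqVneq (y (b^-1 * a)%g) 0; first by rewrite mul0r.
  have [->|z0] := eqVneq (z (a^-1 * h)%g) 0; first by rewrite act0 mulr0.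
  by case: nXa; split=> //; exists b, (b^-1 * a)%g.
transitivity (\sum_(b \in Y) \sum_(a \in X)
    x b * act b (y (b^-1 * a)%g) * act a (z (a^-1 * h)%g)).
  rewrite (@conv_eq _ _ _ Y) //; last first.
    move=> b Tb xb; rewrite inner // => /fsum_neq0[a Xa] t0; exists a => //.
    by split=> //; apply: contra_neq t0 => ->; rewrite mul0r.
  apply: eq_fsbigr => b; rewrite inE => -[a0 _ [_ xb _]].
  rewrite /term inner // act_fsum // fsbig_distrr //.
  by apply: eq_fsbigr => a _; rewrite cactM -cact_mul fac /= mulrA.
rewrite exchange_fsbig // (@conv_eq _ _ _ X); first last.
- by move=> a Ta /conv_neq0.
- by move=> a [].
apply: eq_fsbigr => a; rewrite inE => Xa.
rewrite /term (@conv_eq _ _ _ Y) //; last by move=> b Tb xb yb; exists a.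
by rewrite !fsbig_finite // mulr_suml.
Qed.

Lemma convDl x y z h : hwo (supp x) -> hwo (supp y) -> hwo (supp z) ->
  conv (fun k => x k + y k) z h = conv x z h + conv y z h.
Proof.
move=> wx wy wz; have fX := finite_fiber_supp h wx wz.
have fY := finite_fiber_supp h wy wz.
have UT : fiber x z h `|` fiber y z h `<=` T by move=> a [|] [].
rewrite !(@conv_eq _ _ _ (fiber x z h `|` fiber y z h)) //.
- rewrite -fsbig_split ?finite_setU //.
  by apply: eq_fsbigr => a _; rewrite /term mulrDl.
- by move=> a *; right.
- by move=> a *; left.
move=> a Ta xya za; have [x0|x0] := eqVneq (x a) 0; last by left.
by right; split=> //; rewrite x0 add0r in xya.
Qed.

Lemma convDr x y z h : hwo (supp x) -> hwo (supp y) -> hwo (supp z) ->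
  conv x (fun k => y k + z k) h = conv x y h + conv x z h.
Proof.
move=> wx wy wz; have fX := finite_fiber_supp h wx wy.
have fY := finite_fiber_supp h wx wz.
have UT : fiber x y h `|` fiber x z h `<=` T by move=> a [|] [].
rewrite !(@conv_eq _ _ _ (fiber x y h `|` fiber x z h)) //.
- rewrite -fsbig_split ?finite_setU //.
  by apply: eq_fsbigr => a _; rewrite /term cactD mulrDr.
- by move=> a *; right.
- by move=> a *; left.
move=> a Ta xa yza; have [y0|y0] := eqVneq (y (a^-1 * h)%g) 0; last by left.
by right; split=> //; rewrite y0 add0r in yza.
Qed.

(** The monomial with coefficient [p] and exponent [h]; equivariance forces its values on the rest
    of the coset. *)
Definition single p h k : C :=
  if `[< heqv h k >] then p * (iota (k * h^-1)%g)^-1 else 0.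

Lemma single_equivariant p h : equivariant (single p h).
Proof.
move=> n k kn; rewrite /single.
have nk := heqv_kerl k kn.
case: asboolP => hn; case: asboolP => hk.
- have /heqv_ker kk := hk.
  by rewrite -mulgA (@ciotaM D n) // invrM ?iota_unit // mulrA.
- by case: hk; apply: heqv_trans hn _; exact: heqv_sym.
- by case: hn; exact: heqv_trans nk.
- by rewrite mul0r.
Qed.

Lemma single_wo p h : hwo (supp (single p h)).
Proof.
move=> B BS [b Bb]; exists b; split=> // a Ba.
have hs c : B c -> heqv h c.
  by move=> /BS; rewrite /supp /= /single; case: asboolP => //; rewrite eqxx.
have : heqv a b by apply: heqv_trans (hs _ Bb); exact/heqv_sym/hs.
by move=> /heqvP[].
Qed.

Lemma single_id p h : single p h h = p.
Proof.
rewrite /single asboolT; last exact: heqv_refl.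
by rewrite mulgV ciota1 invr1 mulr1.
Qed.

(** * Leading terms of convolutions *)

Definition lead x h := x h != 0 /\ forall k, hlt k h -> x k = 0.

Lemma conv_low x y h k l : (forall a, hlt a h -> x a = 0) ->
  (forall b, hlt b k -> y b = 0) -> hlt l (h * k)%g -> conv x y l = 0.
Proof.
move=> xh yk lhk; apply/eqP/negPn/negP => /conv_neq0[a [b [xa yb lE]]].
move: lhk; rewrite lE; apply: hle_trans (_ : ~ hlt (h * b) (h * k))%g _.
  by rewrite hlt_mull => /yk; exact/eqP.
by move=> /hlt_mulr /xh; exact/eqP.
Qed.

(** Only the coset of [h] contributes: a left factor strictly beyond [h] would need a right factor
    strictly before [k]. *)
Lemma conv_leading x y h k : equivariant x -> equivariant y ->
  (forall a, hlt a h -> x a = 0) -> (forall b, hlt b k -> y b = 0) ->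
  conv x y (h * k)%g = x h * act h (y k).
Proof.
move=> ex ey xh yk; have rT := @trans_rep _ h.
rewrite (@conv_eq _ _ _ [set rep h]).
- rewrite fsbig_set1 -(@term_eqv x y (h * k)%g h) ?/term ?mulKg //.
  exact: heqv_rep.
- by move=> _ ->.
move=> a Ta xa ya; rewrite -Ta; apply/esym/rep_eqv/heqvP; split; last first.
  by move=> /xh; exact/eqP.
move=> ha; move/eqP: ya; apply; apply: yk.
by rewrite -(hlt_mull a) mulgA mulgV mul1g; apply/hlt_mulr.
Qed.

Lemma conv1l x : equivariant x -> conv (single 1 1%g) x = x.
Proof.
move=> ex; apply/funext => h.
have s1 := @single_equivariant 1 1%g.
rewrite (@conv_eq _ _ _ [set rep 1%g]).
- rewrite fsbig_set1 -(@term_eqv _ x h 1%g) //; last exact: heqv_rep.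
  by rewrite /term single_id invg1 !mul1g cact_one mul1r.
- by move=> _ ->; exact: trans_rep.
move=> a Ta; rewrite /single; case: asboolP; last by rewrite eqxx.
by move=> a1 _ _; rewrite -Ta; exact/esym/rep_eqv.
Qed.

Lemma conv1r x : equivariant x -> conv x (single 1 1%g) = x.
Proof.
move=> ex; apply/funext => h.
have s1 := @single_equivariant 1 1%g.
rewrite (@conv_eq _ _ _ [set rep h]).
- rewrite fsbig_set1 -(@term_eqv x _ h h) //; last exact: heqv_rep.
  by rewrite /term mulVg single_id cact1 mulr1.
- by move=> _ ->; exact: trans_rep.
move=> a Ta _; rewrite /single; case: asboolP; last by rewrite eqxx.
rewrite -{1}(mulVg a) heqv_mull.
by move=> a1 _; rewrite -Ta; exact/rep_eqv.
Qed.

End Convolution.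

(** * The skew field of twisted Hahn series *)

Section DivisionRing.
Variable K : nzRingType.
Hypothesis right_inv : forall x : K, x != 0 -> exists y, x * y = 1.
Implicit Types x y : K.

(** The default 0 matters: an inverse must fix nonunits, and 0 is the only one. *)
Definition division_inv x := xget 0 [set y | x * y = 1 /\ y * x = 1].

Definition division_unit : pred K := [pred x | x != 0].

(** A right inverse [y] of [x] has a right inverse [z] in turn, and associativity gives [z = x]. *)
Lemma division_invP x : x != 0 ->
  x * division_inv x = 1 /\ division_inv x * x = 1.
Proof.
move=> x0; apply: (@xgetPex _ _ [set y | x * y = 1 /\ y * x = 1]).
have [y xy] := right_inv x0; exists y; split=> //.
have [|z yz] := @right_inv y.
  by apply/eqP => y0; move/eqP: xy; rewrite y0 mulr0 eq_sym oner_eq0.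
by rewrite -yz; congr (_ * _); rewrite -[x]mulr1 -yz mulrA xy mul1r.
Qed.

Lemma division_mulVr : {in division_unit, left_inverse 1 division_inv *%R}.
Proof. by move=> x /division_invP[]. Qed.

Lemma division_divrr : {in division_unit, right_inverse 1 division_inv *%R}.
Proof. by move=> x /division_invP[]. Qed.

Lemma division_unitP x y : y * x = 1 /\ x * y = 1 -> division_unit x.
Proof.
by move=> [yx _]; apply/eqP => x0; move/eqP: yx; rewrite x0 mulr0 eq_sym oner_eq0.
Qed.

Lemma division_inv_out : {in [predC division_unit], division_inv =1 id}.
Proof.
move=> x; rewrite inE /= negbK => /eqP ->; apply: xgetPN => y [+ _].
by rewrite mul0r => /eqP; rewrite eq_sym oner_eq0.
Qed.

Definition division_ring_mixin : GRing.NzRing_hasMulInverse K :=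
  GRing.NzRing_hasMulInverse.Build K
  division_mulVr division_divrr division_unitP division_inv_out.

End DivisionRing.

Record hahn (D : crossed_system) := Hahn {
  hahn_fun :> cgrp D -> cring D;
  hahn_equivariant : equivariant hahn_fun;
  hahn_wo : hwo (supp hahn_fun) }.

HB.instance Definition _ (D : crossed_system) := gen_eqMixin (hahn D).
HB.instance Definition _ (D : crossed_system) := gen_choiceMixin (hahn D).

Section HahnRing.
Variable D : crossed_system.
Local Notation H := (cgrp D).
Local Notation C := (cring D).
Implicit Types (x y z : hahn D) (h k : H).

Lemma hahnP x y : (forall h, x h = y h) -> x = y.
Proof.
case: x y => [x ex wx] [y ey wy] /= xy.
have {}xy : x = y by apply/funext.
by subst y; congr Hahn; exact: Prop_irrelevance.
Qed.

Definition hahn_zero : hahn D.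
Proof.
exists (fun=> 0); first by move=> n h _; rewrite mul0r.
by move=> B BS [b /BS]; rewrite /supp /= eqxx.
Defined.

Definition hahn_opp x : hahn D.
Proof.
exists (fun h => - x h).
  by move=> n h kn; rewrite hahn_equivariant // mulNr.
by apply: hwoS (@hahn_wo _ x) => h; rewrite /supp /= oppr_eq0.
Defined.

Definition hahn_add x y : hahn D.
Proof.
exists (fun h => x h + y h).
  by move=> n h kn; rewrite !hahn_equivariant // mulrDl.
apply: hwoS (hwoU (@hahn_wo _ x) (@hahn_wo _ y)) => h; rewrite /supp /=.
have [x0|x0] := eqVneq (x h) 0; last by left.
by rewrite x0 add0r; right.
Defined.

Definition hahn_mul x y : hahn D :=
  Hahn (conv_equivariant (@hahn_equivariant _ x) (@hahn_equivariant _ y)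
         (@hahn_wo _ x) (@hahn_wo _ y))
       (conv_wo (@hahn_wo _ x) (@hahn_wo _ y)).

Definition hahn_single (p : C) h : hahn D :=
  Hahn (@single_equivariant D p h) (@single_wo D p h).

Definition hahn_one := hahn_single 1 1%g.

Lemma hahn_addA : associative hahn_add.
Proof. by move=> x y z; apply: hahnP => h /=; rewrite addrA. Qed.

Lemma hahn_addC : commutative hahn_add.
Proof. by move=> x y; apply: hahnP => h /=; rewrite addrC. Qed.

Lemma hahn_add0 : left_id hahn_zero hahn_add.
Proof. by move=> x; apply: hahnP => h /=; rewrite add0r. Qed.

Lemma hahn_addN : left_inverse hahn_zero hahn_opp hahn_add.
Proof. by move=> x; apply: hahnP => h /=; rewrite addNr. Qed.

HB.instance Definition _ := GRing.isZmodule.Build (hahn D)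
  hahn_addA hahn_addC hahn_add0 hahn_addN.

Lemma hahnDE x y h : (x + y) h = x h + y h. Proof. by []. Qed.
Lemma hahnNE x h : (- x) h = - x h. Proof. by []. Qed.
Lemma hahn_mulA : associative hahn_mul.
Proof.
move=> x y z; apply: hahnP => h /=.
by rewrite convA //; [exact: hahn_equivariant|exact: hahn_equivariant|
  exact: hahn_equivariant|exact: hahn_wo|exact: hahn_wo|exact: hahn_wo].
Qed.

Lemma hahn_mul1l : left_id hahn_one hahn_mul.
Proof.
by move=> x; apply: hahnP => h /=; rewrite conv1l //; exact: hahn_equivariant.
Qed.

Lemma hahn_mul1r : right_id hahn_one hahn_mul.
Proof.
by move=> x; apply: hahnP => h /=; rewrite conv1r //; exact: hahn_equivariant.
Qed.

Lemma hahn_mulDl : left_distributive hahn_mul +%R.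
Proof.
by move=> x y z; apply: hahnP => h /=; rewrite convDl //; exact: hahn_wo.
Qed.

Lemma hahn_mulDr : right_distributive hahn_mul +%R.
Proof.
by move=> x y z; apply: hahnP => h /=; rewrite convDr //; exact: hahn_wo.
Qed.

Lemma hahn_one_neq0 : hahn_one != 0.
Proof.
apply/eqP => /(congr1 (fun x : hahn D => x 1%g)) /=.
by rewrite single_id => /eqP; rewrite oner_eq0.
Qed.

HB.instance Definition _ := GRing.Zmodule_isNzRing.Build (hahn D)
  hahn_mulA hahn_mul1l hahn_mul1r hahn_mulDl hahn_mulDr hahn_one_neq0.

Lemma hahnME x y h : (x * y) h = conv x y h. Proof. by []. Qed.

Lemma lead_exists x : x != 0 -> exists h, lead x h.
Proof.
move=> x0; have [//||h [x1 mh]] := @hahn_wo _ x (supp x).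
  apply: contrapT => s0; move/eqP: x0; apply; apply: hahnP => h.
  by apply/eqP/negPn/negP => xh; apply: s0; exists h.
by exists h; split=> // k kh; apply/eqP/negPn/negP => /mh.
Qed.

Lemma mul_leading x y h k : lead x h -> lead y k ->
  (x * y) (h * k)%g = x h * @cact D h (y k).
Proof.
by move=> [_ xh] [_ yk]; apply: conv_leading => //; exact: hahn_equivariant.
Qed.

Lemma cring_mul_neq0 (p q : C) : p != 0 -> q != 0 -> p * q != 0.
Proof.
move=> p0 q0; have pu := cring_field p0; apply: contra_neq q0 => pq.
by apply: (mulrI pu); rewrite mulr0.
Qed.

Lemma lead_mul x y h k : lead x h -> lead y k -> lead (x * y) (h * k)%g.
Proof.
move=> lx ly; split.
  rewrite mul_leading //; apply: cring_mul_neq0; first by case: lx.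
  by rewrite act_eq0; case: ly.
by move=> l; apply: conv_low; [case: lx|case: ly].
Qed.

Lemma hahn_eqv0 x h k : heqv h k -> x h = 0 -> x k = 0.
Proof. by apply: equivariant_eqv0; exact: hahn_equivariant. Qed.

(** * Right inverses of series *)

Section RightInverse.
Variables (x : hahn D) (h0 : H).
Hypothesis lx : lead x h0.

Definition solved y h := forall k, ~ hlt h k -> (1 - x * y) k = 0.

Lemma solved_down y h k : ~ hlt h k -> solved y h -> solved y k.
Proof. by move=> hk sy l kl; exact/sy/(hle_trans kl hk). Qed.

(** Otherwise [y - z] has a leading exponent [k] not beyond [h], so [x * (y - z)] is nonzero at
    [h0 * k]; but it is the difference of the two errors, which vanish there. *)
Lemma solved_unique y z h : solved y (h0 * h)%g -> solved z (h0 * h)%g ->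
  y h = z h.
Proof.
move=> sy sz; apply/eqP; rewrite -subr_eq0 -hahnNE -hahnDE; apply/negPn/negP.
move=> yzh; have [|k lk] := @lead_exists (y - z).
  by apply: contra_neq yzh => ->.
have [+ _] := lead_mul lx lk; have [_ kmin] := lk.
have -> : x * (y - z) = (1 - x * z) - (1 - x * y).
  by rewrite [RHS]addrC opprB addrA subrK mulrBr.
have kh : ~ hlt (h0 * h)%g (h0 * k)%g.
  by rewrite hlt_mull => /kmin; exact/eqP.
by rewrite hahnDE hahnNE sy // sz // subrr eqxx.
Qed.

Lemma limit_exists : exists t : hahn D,
  forall y h, solved y (h0 * h)%g -> t h = y h.
Proof.
pose t h := if pselect (exists y, solved y (h0 * h)%g) is left e
            then projT1 (cid e) h else 0.
have tE y h : solved y (h0 * h)%g -> t h = y h.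
  move=> sy; rewrite /t; case: pselect => [e|[]]; last by exists y.
  by case: cid => z /= sz; exact: solved_unique.
have et : equivariant t.
  move=> n h kn; have /heqvP[h1 h2] : heqv (h0 * h)%g (h0 * (n * h))%g.
    by rewrite heqv_mull; exact: heqv_kerl.
  have [[y sy]|ny] := pselect (exists y, solved y (h0 * h)%g).
    rewrite (tE y h sy) (tE y (n * h)%g (solved_down h1 sy)).
    by rewrite hahn_equivariant.
  have -> : t h = 0 by rewrite /t; case: pselect.
  rewrite mul0r /t; case: pselect => // -[y sy]; case: ny; exists y.
  exact: (solved_down h2 sy).
suff wt : hwo (supp t) by exists (Hahn et wt).
move=> B Bt [b Bb].
(* Up to [b] the glued [t] coincides with this single series, which supplies the minimum. *)
have [y sy] : exists y, solved y (h0 * b)%g.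
  by have := Bt _ Bb; rewrite /supp /= /t; case: pselect; rewrite ?eqxx.
have [||m [[Bm bm] mm]] := @hahn_wo _ y (B `&` [set a | ~ hlt b a]).
- move=> a [Ba /= ab]; have := Bt _ Ba; rewrite /supp /= (tE y) //.
  by apply: (solved_down _ sy); rewrite hlt_mull.
- by exists b; split=> //; exact: hlt_irr.
exists m; split=> // a Ba am; apply: (mm a) => //; split=> //= ba.
by apply: bm; exact: hlt_trans am.
Qed.

(* All approximate solutions agree where they are determined, so they glue to
   a single series [t] which solves the equation wherever some series does; a
   monomial correction at the first error of [t] would do better than [t]. *)
Lemma right_inverse_exists : exists y, x * y = 1.
Proof.
have [t tE] := limit_exists; have [xh0 xlow] := lx.
(* If [a * b] is not beyond [h] and [a] is not before [h0], then [h0 * b] is not beyond [h], so [y]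
   and [t] agree at [b]; hence [x * (y - t)] vanishes up to [h]. *)
have tmax y h : solved y h -> solved t h.
  move=> sy k hk; have -> : 1 - x * t = (1 - x * y) + x * (y - t).
    by rewrite mulrBr addrA subrK.
  rewrite hahnDE sy // add0r; apply/eqP/negPn/negP.
  rewrite hahnME => /conv_neq0[a [b [xa ytb kE]]].
  move: ytb; rewrite hahnDE hahnNE (tE y) ?subrr ?eqxx //.
  apply: (solved_down _ sy); rewrite kE in hk; apply: (hle_trans _ hk).
  by move=> /hlt_mulr /xlow /eqP; exact/negP.
exists t; apply/eqP; rewrite eq_sym -subr_eq0; apply/negPn/negP.
move=> /lead_exists[k lr]; have [rk rlow] := lr; set r := 1 - x * t in rk rlow lr.
(* The solution of [x h0 * cact h0 c = r k], so that [x * z] has the leading term of [r]. *)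
pose c := @cact D h0^-1%g ((x h0)^-1 * r k).
pose z := hahn_single c (h0^-1 * k)%g.
have zlow b : hlt b (h0^-1 * k)%g -> z b = 0.
  by move=> bk; rewrite /= /single; case: asboolP => // /heqvP[_ []].
have xzk : (x * z) k = r k.
  rewrite hahnME (_ : k = h0 * (h0^-1 * k))%g; last by rewrite mulgA mulgV mul1g.
  rewrite conv_leading //; try exact: hahn_equivariant.
  rewrite /= single_id /c -cact_mul mulgV cact_one mulrA divrr ?mul1r //.
    by rewrite mulgA mulgV mul1g.
  exact: cring_field.
move/eqP: rk; apply.
suff /tmax/(_ k) : solved (t + z) k by apply; exact: hlt_irr.
move=> j kj; rewrite mulrDr opprD addrA -/r.
have [jk|jk] := pselect (hlt j k).
  rewrite hahnDE hahnNE rlow // hahnME.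
  rewrite (@conv_low D x z h0 (h0^-1 * k)%g) ?subr0 //.
  by rewrite mulgA mulgV mul1g.
apply: (@hahn_eqv0 _ k); first by apply/heqvP.
by rewrite hahnDE hahnNE xzk subrr.
Qed.

End RightInverse.

Lemma hahn_right_inverse x : x != 0 -> exists y, x * y = 1.
Proof. by move=> /lead_exists[h]; exact: right_inverse_exists. Qed.

HB.instance Definition _ : GRing.NzRing_hasMulInverse (hahn D) :=
  division_ring_mixin hahn_right_inverse.

Lemma hahn_field : GRing.field_axiom (hahn D).
Proof. by []. Qed.

End HahnRing.

(** * Stringent skew hyperfields *)

Declare Scope hyper_scope.
Delimit Scope hyper_scope with hyper.
Local Notation "x * y" := (hmul x y) : hyper_scope.
Local Notation "- x" := (hopp x) : hyper_scope.
Local Notation "0" := (hzero _) : hyper_scope.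
Local Notation "1" := (hone _) : hyper_scope.
Local Notation "- 1" := (hopp (hone _)) : hyper_scope.

Section HyperArithmetic.
Variable R : skewHyperfield.
Local Open Scope hyper_scope.
Implicit Types a b c u v w x y z : R.

Let ring : is_skew_hyperring (@hmul R) (@hadd R) 1 0 (@hopp R) :=
  hyperfield_hyperring (hyperfieldP R).
Let hgrp := hyperring_hypergroup ring.

Lemma hmulA x y z : x * (y * z) = x * y * z.
Proof. exact: hyperring_mulA ring _ _ _. Qed.

Lemma hmul1l x : 1 * x = x. Proof. exact: hyperring_mul1l ring _. Qed.
Lemma hmul1r x : x * 1 = x. Proof. exact: hyperring_mul1r ring _. Qed.
Lemma hmul0l x : 0 * x = 0. Proof. exact: hyperring_mul0l ring _. Qed.
Lemma hmul0r x : x * 0 = 0. Proof. exact: hyperring_mul0r ring _. Qed.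

Lemma haddC x y : hadd x y = hadd y x.
Proof. exact: hyperring_addC ring _ _. Qed.

Lemma hadd0l x : hadd 0 x = [set x].
Proof. exact: hypergroup_add0l hgrp _. Qed.

Lemma hone_neq0 : (1 : R) <> 0.
Proof. by move=> /esym; exact: hyperfield_zero_neq_one (hyperfieldP R). Qed.

Lemma hadd_ex x y : exists z, hadd x y z.
Proof. by have [z xyz] := hypergroup_nonempty hgrp x y; exists z. Qed.

Lemma haddAr a b c u v : hadd b c u -> hadd a u v ->
  exists2 w, hadd a b w & hadd w c v.
Proof.
move=> bcu auv; have : hadd_set (@hadd R) [set a] (hadd b c) v.
  by exists a => //; exists u.
by rewrite (hypergroup_assoc hgrp) => -[w abw [_ -> wcv]]; exists w.
Qed.

Lemma haddAl a b c w v : hadd a b w -> hadd w c v ->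
  exists2 u, hadd b c u & hadd a u v.
Proof.
rewrite haddC [hadd w c]haddC => baw cwv.
have [u cbu uav] := haddAr baw cwv.
by exists u; rewrite haddC.
Qed.

Lemma haddN x : hadd x (- x) 0.
Proof. by have [] := hypergroup_oppr hgrp x. Qed.

Lemma hopp_uniq x y : hadd x y 0 -> y = - x.
Proof. by have [_ u] := hypergroup_oppr hgrp x; move/u. Qed.

Lemma hoppK x : - - x = x.
Proof. by apply/esym/hopp_uniq; rewrite haddC; exact: haddN. Qed.

Lemma hopp0 : - (0 : R) = 0.
Proof. by apply/esym/hopp_uniq; rewrite hadd0l. Qed.

Lemma hopp_inj x y : - x = - y -> x = y.
Proof. by move=> e; rewrite -[x]hoppK e hoppK. Qed.

Lemma haddNN x y z : hadd y z x -> hadd (- y) (- z) (- x).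
Proof. by move=> /(hypergroup_rev hgrp); rewrite haddC. Qed.

(* Reversibility: the axiom [hypergroup_rev] only says that negation is an
   automorphism, but associativity gives the rest. *)
Lemma hadd_rev x y z : hadd y z x -> hadd x (- z) y.
Proof.
move=> yzx; have [u zxu yu0] := haddAl yzx (haddN x).
rewrite -[y]hoppK -(hopp_uniq yu0) -[x]hoppK haddC.
exact: haddNN.
Qed.

Lemma hadd_mull a x y z : hadd x y z -> hadd (a * x) (a * y) (a * z).
Proof. by move=> xyz; rewrite -(hyperring_distl ring); exists z. Qed.

Lemma hadd_mulr a x y z : hadd x y z -> hadd (x * a) (y * a) (z * a).
Proof. by move=> xyz; rewrite -(hyperring_distr ring); exists z. Qed.

Lemma hmulN1l x : - 1 * x = - x.
Proof.
apply: hopp_uniq; rewrite -{1}[x]hmul1l -[0](hmul0l x).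
exact/hadd_mulr/haddN.
Qed.

Lemma hmulN1r x : x * - 1 = - x.
Proof.
apply: hopp_uniq; rewrite -{1}[x]hmul1r -[0](hmul0r x).
exact/hadd_mull/haddN.
Qed.

Lemma hmulNl x y : - x * y = - (x * y).
Proof. by rewrite -hmulN1l -hmulA hmulN1l. Qed.

Lemma hmulNr x y : x * - y = - (x * y).
Proof. by rewrite -hmulN1r hmulA hmulN1r. Qed.

Lemma hmul_ex x : x <> 0 -> exists y, x * y = 1 /\ y * x = 1.
Proof. exact: hyperfield_inv (hyperfieldP R) _. Qed.

Lemma hmul_inv_sym x y : x * y = 1 -> y * x = 1.
Proof.
move=> xy; have y0 : y <> 0.
  by move=> y0; apply: hone_neq0; rewrite -xy y0 hmul0r.
have [z [yz zy]] := hmul_ex y0.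
by rewrite -[x]hmul1r -yz [x * _]hmulA xy hmul1l.
Qed.

Lemma hmul_neq0 x y : x <> 0 -> y <> 0 -> x * y <> 0.
Proof.
move=> x0 y0 xy0; have [x' [_ x'x]] := hmul_ex x0.
by apply: y0; rewrite -[y]hmul1l -x'x -hmulA xy0 hmul0r.
Qed.

(* [hS] is 1 - 1, the set of elements absorbed by 1. *)
Definition hS : set R := hadd 1 (- 1).
Definition small c := [/\ hS c, c <> 1 & c <> - 1].

Lemma hSP c : hS c <-> hadd 1 c 1.
Proof.
by rewrite [hadd 1 c]haddC; split=> /hadd_rev //; rewrite hoppK.
Qed.

Lemma small0 : small 0.
Proof.
split; first exact: haddN.
  by move=> /esym; exact: hone_neq0.
by move=> /(congr1 (@hopp R)); rewrite hopp0 hoppK => /esym; exact: hone_neq0.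
Qed.

Lemma small1 : ~ small 1. Proof. by case. Qed.

Lemma smallN c : small c -> small (- c).
Proof.
move=> [Sc c1 cN1]; split.
- by have := haddNN Sc; rewrite hoppK haddC.
- by move=> e; apply: cN1; rewrite -e hoppK.
- by move=> /hopp_inj.
Qed.

Lemma small_conj a b c : a * b = 1 -> small c -> small (a * c * b).
Proof.
move=> ab [Sc c1 cN1]; have ba := hmul_inv_sym ab.
have cE : c = b * (a * c * b) * a.
  by rewrite !hmulA ba hmul1l -hmulA ba hmul1r.
split.
- by have := hadd_mulr b (hadd_mull a Sc); rewrite hmul1r ab hmulN1r hmulNl ab.
- by move=> e; apply: c1; rewrite cE e hmul1r.
- by move=> e; apply: cN1; rewrite cE e hmulN1r hmulNl ba.
Qed.

Hypothesis hR : stringent R.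

Lemma hadd_single a b u v : a <> - b -> hadd a b u -> hadd a b v -> u = v.
Proof. by move=> /hR[c ->] -> ->. Qed.

(** Membership in 1 - 1 only puts 1 into 1 + [c]; stringency makes it the sole element because [c]
    is not -1. *)
Lemma small_add1 c v : small c -> hadd 1 c v -> v = 1.
Proof.
move=> [/hSP Sc _ cN1]; move/hadd_single; apply=> //.
by move=> e; apply: cN1; rewrite e hoppK.
Qed.

(** Multiplying the absorption of [b] by 1 with [a] puts [a] into [a] + 1, which is {1}. *)
Lemma small_inv a b : small a -> small b -> a * b <> 1.
Proof.
move=> sa sb ab; have [_ + _] := sa; apply.
have [/hSP Sb _ _] := sb.
by apply: (small_add1 sa); have := hadd_mull a Sb; rewrite ab hmul1r haddC.
Qed.

Lemma small_mul a b : small a -> small b -> small (a * b).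
Proof.
move=> sa sb; split; last 2 first.
- exact: small_inv.
- move=> e; apply: (small_inv (smallN sa) sb).
  by rewrite hmulNl e hoppK.
have [/hSP Sa _ _] := sa; have [/hSP Sb _ _] := sb; apply/hSP.
have := hadd_mulr b Sa; rewrite hmul1l => bab.
by have [w /(small_add1 sb) ->] := haddAr bab Sb.
Qed.

Lemma small_add a b c : small a -> small b -> hadd a b c -> small c.
Proof.
have n1 x y : small x -> small y -> ~ hadd x y 1.
  move=> sx sy; rewrite haddC => /hadd_rev /(small_add1 (smallN sx)).
  by case: sy.
move=> sa sb abc; split; last 2 first.
- by move=> e; apply: (n1 a b) => //; rewrite -e.
- move=> e; apply: (n1 _ _ (smallN sa) (smallN sb)).
  by have := haddNN abc; rewrite e hoppK.
have [v cv] := hadd_ex 1 c; apply/hSP.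
have [w /(small_add1 sa) w1] := haddAr abc cv.
by rewrite w1 => /(small_add1 sb) v1; rewrite v1 in cv.
Qed.

Lemma hS_small c : ~ hS (1 : R) -> hS c -> small c.
Proof.
move=> n1 Sc; split=> //; first by move=> c1; rewrite c1 in Sc.
by move=> c1; apply: n1; have := haddNN Sc; rewrite c1 !hoppK haddC.
Qed.

(* With [w] the element of 1 + [u], the memberships of 1 in 1 + 1 and of [u] in
   [u] + [u] make 1 and [u] both absorbed by [w]; as they add up to [w], they
   are not both negligible against it, so one of them is [w] up to sign, and it
   cannot be 1. *)
Lemma small_inv_total u v : hS (1 : R) -> u * v = 1 -> ~ hS u -> small v.
Proof.
move=> S1 uv nSu; have vu := hmul_inv_sym uv; have /hSP one2 := S1.
have u2 := hadd_mull u one2; rewrite hmul1r in u2.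
have uN1 : 1 <> - u.
  move=> e; apply: nSu; rewrite -[u]hoppK -e.
  by have := haddNN S1; rewrite hoppK haddC.
have [w w1u] := hadd_ex 1 u.
have single1u x : hadd 1 u x -> x = w by move=> /(hadd_single uN1); apply.
have w1 : hadd w 1 w.
  have [x] := haddAl one2 w1u; move/single1u => -> ww.
  by rewrite haddC.
have wu : hadd w u w by have [x /single1u ->] := haddAr u2 w1u.
have S1w : hadd w (- w) 1 by apply: hadd_rev; rewrite haddC.
have Suw : hadd w (- w) u by apply: hadd_rev; rewrite haddC.
have w0 : w <> 0.
  move=> e; apply: uN1; rewrite e in w1u; rewrite (hopp_uniq w1u) hoppK //.
have [t [wt tw]] := hmul_ex w0.
have St : hS t by have := hadd_mull t S1w; rewrite hmulNr tw hmul1r.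
have Stu : hS (t * u) by have := hadd_mull t Suw; rewrite hmulNr tw.
have t1 : t <> 1.
  by move=> e; apply: nSu; rewrite e hmul1l in Stu.
have tN1 : t <> - 1.
  move=> e; apply: nSu; rewrite e hmulN1l in Stu.
  by have := haddNN Stu; rewrite !hoppK haddC.
have st : small t by [].
have [tu1|tu1] := pselect (t * u = 1).
  by rewrite -[v]hmul1l -tu1 -hmulA uv hmul1r.
have [tuN1|tuN1] := pselect (t * u = - 1).
  rewrite -[v]hmul1l -[1]hoppK -tuN1 hmulNl -hmulA uv hmul1r.
  exact: smallN.
have stu : small (t * u) by [].
case: small1; apply: (small_add st stu).
by have := hadd_mull t w1u; rewrite tw hmul1r.
Qed.

(** For [x] other than -1, let [w] be the only element of 1 + [x]. Since [y] is not in 1 - 1, [w]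
    differs from [x], so [w] - [x] = {1}. As [x * a] lies in [x] - [x], the set 1 + [x * a] is
    contained in (1 + [x]) - [x] = {1}. *)
Lemma hS_mul x y a : ~ hS (1 : R) -> x * y = 1 -> ~ hS y -> hS a -> hS (x * a).
Proof.
move=> nS1 xy nSy Sa.
have xNx : hadd x (- x) (x * a).
  by have := hadd_mull x Sa; rewrite hmulNr hmul1r.
have [xN1|xN1] := pselect (x = - 1).
  by rewrite xN1 hmulN1l; have := haddNN Sa; rewrite hoppK haddC.
have [w w1x] := hadd_ex 1 x.
have single1x u : hadd 1 x u -> u = w.
  move=> /hadd_single; apply=> // e; apply: xN1.
  by rewrite e hoppK.
have wx : - w <> - x.
  move=> /hopp_inj e; rewrite e in w1x; apply: nSy.
  by have := hadd_mull y (hadd_rev w1x); rewrite hmulNr (hmul_inv_sym xy) hmul1r.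
have wNx v : hadd w (- x) v -> v = 1.
  move=> wxv; apply: (@hadd_single w (- x)) wxv (hadd_rev w1x).
  by rewrite hoppK => e; apply: wx; rewrite e.
have [v v1] := hadd_ex 1 (x * a); apply/hSP.
have [u /single1x ->] := haddAr xNx v1; move=> /wNx v1E.
by rewrite v1E in v1.
Qed.

(** If 1 lies in 1 - 1, then [x] is 1, -1 or itself negligible; otherwise being negligible is the
    same as lying in 1 - 1, and [hS_mul] applies. *)
Lemma small_mull x y a : x * y = 1 -> ~ small y -> small a -> small (x * a).
Proof.
move=> xy ny sa; have [S1|nS1] := pselect (hS (1 : R)).
  have [y1|y1] := pselect (y = 1); first by rewrite -[x]hmul1r -y1 xy hmul1l.
  have [yN1|yN1] := pselect (y = - 1).
    by rewrite -[x]hoppK -hmulN1r -yN1 hmulNl xy hmulN1l; exact: smallN.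
  apply: small_mul => //; apply: (small_inv_total S1 (hmul_inv_sym xy)).
  by move=> Sy; apply: ny.
apply: hS_small => //; apply: hS_mul xy _ _ => // [Sy|]; last by case: sa.
by apply: ny; exact: hS_small.
Qed.

End HyperArithmetic.

(** * Realization by leading terms *)

(* [u] identifies [cgrp D] with the nonzero elements of [R], and [lam] maps the
   coefficients onto the elements of [R] comparable with 1. The value of a
   series is its leading coefficient times its leading exponent, read in [R]. *)
Section Realization.
Variables (R : skewHyperfield) (D : crossed_system).
Variables (u : cgrp D -> R) (lam : cring D -> R).
Hypothesis hR : stringent R.
Hypothesis uM : forall a b, u (a * b)%g = (u a * u b)%hyper.
Hypothesis u_neq0 : forall a, u a <> 0%hyper.
Hypothesis u_surj : forall r, r <> 0%hyper -> exists a, u a = r.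
Hypothesis u_small : forall a, cpos a <-> small (u a).
Hypothesis lam0 : lam 0 = 0%hyper.
Hypothesis lam_ker : forall p, p != 0 -> exists2 n, ker n & lam p = u n.
Hypothesis lamM : forall p q, lam (p * q) = (lam p * lam q)%hyper.
Hypothesis lam_act : forall a p, (lam (cact a p) * u a = u a * lam p)%hyper.
Hypothesis lam_iota : forall n, ker n -> lam (ciota n) = u n.
Hypothesis lamD : forall p q, hadd (lam p) (lam q) (lam (p + q)).
(** If 1 lies in 1 + 1, two coefficients of value 1 must witness this; generic lifts need not. *)
Hypothesis lam_idem : hS (1%hyper : R) ->
  exists p q, [/\ lam p = 1, lam q = 1 & lam (p + q) = 1]%hyper.

Local Notation H := (cgrp D).
Implicit Types (x y z : hahn D) (h k l : H) (r s t : R) (p q : cring D).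

Lemma u1 : u 1%g = 1%hyper.
Proof.
have [v [uv _]] := hmul_ex (@u_neq0 1%g).
by rewrite -uv -{2}[1%g]mulg1 uM -hmulA uv hmul1r.
Qed.

Lemma lam1 : lam 1 = 1%hyper.
Proof. by rewrite -(ciota1 D) lam_iota ?u1 //; exact: ker1. Qed.

Lemma lam_eq0 p : lam p = 0%hyper -> p = 0.
Proof.
move=> lp; apply/eqP/negPn/negP => /lam_ker[n _].
by rewrite lp => /esym; exact: u_neq0.
Qed.

Lemma hadd_hlt h k : hlt h k -> hadd (u h) (u k) (u h).
Proof.
move=> /u_small[/hSP hk _ _]; have := hadd_mull (u h) hk.
by rewrite hmul1r -uM mulgA mulgV mul1g.
Qed.

Definition hval x : R :=
  if pselect (exists h, lead x h) is left e
  then (lam (x (projT1 (cid e))) * u (projT1 (cid e)))%hyper else 0%hyper.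

Lemma lead_heqv x h k : lead x h -> lead x k -> heqv h k.
Proof.
move=> [xh mh] [xk mk]; apply/heqvP.
by split=> [/mk|/mh]; exact/eqP.
Qed.

Lemma heqv_lead x h k : heqv h k -> lead x h -> lead x k.
Proof.
move=> hk [xh mh]; split.
  by apply: contra_neq xh; apply: hahn_eqv0; exact: heqv_sym.
by move=> l lk; apply: mh; apply: hlt_le_trans lk _; have /heqvP[] := hk.
Qed.

(** Makes [hval] independent of the chosen leading exponent. *)
Lemma lam_equivariant x n h : ker n ->
  (lam (x (n * h)%g) * u (n * h)%g = lam (x h) * u h)%hyper.
Proof.
move=> kn; rewrite hahn_equivariant // -iotaV // lamM uM.
rewrite lam_iota; last exact: kerV.
by rewrite -[LHS]hmulA [(u n^-1%g * _)%hyper]hmulA -uM mulVg u1 hmul1l.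
Qed.

Lemma hvalE x h : lead x h -> hval x = (lam (x h) * u h)%hyper.
Proof.
move=> lx; rewrite /hval; case: pselect => [e|[]]; last by exists h.
case: cid => k /= lk; have /heqv_ker kn := lead_heqv lk lx.
by rewrite -(mulgVK k h) lam_equivariant.
Qed.

Lemma hval0 : hval 0 = 0%hyper.
Proof. by rewrite /hval; case: pselect => // e; have [h [/eqP[]]] := e. Qed.

Lemma lam_neq0 p : p != 0 -> lam p <> 0%hyper.
Proof. by move=> /eqP p0 /lam_eq0. Qed.

Lemma hval_eq0 x : hval x = 0%hyper -> x = 0.
Proof.
move=> vx; apply/eqP/negPn/negP => /lead_exists[h lx].
apply: hmul_neq0 (@u_neq0 h) _; last by rewrite -vx (hvalE lx).
by apply: lam_neq0; case: lx.
Qed.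

Lemma hvalM x y : hval (x * y) = (hval x * hval y)%hyper.
Proof.
have [->|/lead_exists[h lx]] := eqVneq x 0; first by rewrite mul0r hval0 hmul0l.
have [->|/lead_exists[k ly]] := eqVneq y 0; first by rewrite mulr0 hval0 hmul0r.
rewrite (hvalE lx) (hvalE ly) (hvalE (lead_mul lx ly)) mul_leading // lamM uM.
by rewrite -!hmulA; congr hmul; rewrite !hmulA lam_act.
Qed.

Lemma single_lead p h : p != 0 -> lead (hahn_single p h) h.
Proof.
move=> p0; split=> [|k kh] /=; first by rewrite single_id.
by rewrite /single; case: asboolP => // /heqvP[_ /(_ kh)].
Qed.

Lemma hval_single p h : hval (hahn_single p h) = (lam p * u h)%hyper.
Proof.
have [->|p0] := eqVneq p 0; last first.
  by rewrite (hvalE (single_lead h p0)) /= single_id.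
rewrite lam0 hmul0l -hval0; congr hval; apply: hahnP => k /=.
by rewrite /single; case: asboolP; rewrite ?mul0r.
Qed.

Lemma hahn_singleD p q h :
  hahn_single p h + hahn_single q h = hahn_single (p + q) h.
Proof.
apply: hahnP => k; rewrite hahnDE /= /single.
by case: asboolP; rewrite ?mulrDl ?addr0.
Qed.

Lemma hval1 : hval 1 = 1%hyper.
Proof. by rewrite hval_single lam1 u1 hmul1l. Qed.

Lemma hval_ex r : exists x, hval x = r.
Proof.
have [->|/u_surj[h <-]] := pselect (r = 0%hyper); first by exists 0; exact: hval0.
by exists (hahn_single 1 h); rewrite hval_single lam1 hmul1l.
Qed.

Lemma hval_lead x h : lead x h -> exists2 k, heqv h k & hval x = u k.
Proof.
move=> lx; rewrite (hvalE lx); have [|n kn ->] := @lam_ker (x h).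
  by case: lx.
by exists (n * h)%g; [exact: heqv_kerl | rewrite uM].
Qed.

Lemma hlt_heqv h h' k k' : heqv h h' -> heqv k k' -> hlt h k -> hlt h' k'.
Proof.
move=> /heqvP[hh' _] /heqvP[_ kk'] hk.
by apply: hlt_le_trans kk'; exact: hle_lt_trans hk.
Qed.

Lemma hadd_lead x y h k : lead x h -> lead y k -> hlt h k ->
  hadd (hval x) (hval y) (hval x).
Proof.
move=> /hval_lead[h' hh' ->] /hval_lead[k' kk' ->] hk.
by apply: hadd_hlt; exact: hlt_heqv hk.
Qed.

Lemma lead_add x y h k : lead x h -> lead y k -> hlt h k ->
  lead (x + y) h /\ hval (x + y) = hval x.
Proof.
move=> lx [_ yk] hk; have [xh mh] := lx.
have lxy : lead (x + y) h.
  split=> [|l lh]; rewrite hahnDE; first by rewrite yk // addr0.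
  by rewrite mh // yk ?addr0 //; exact: hlt_trans hk.
by split=> //; rewrite (hvalE lx) (hvalE lxy) hahnDE yk // addr0.
Qed.

Lemma hvalD x y : hadd (hval x) (hval y) (hval (x + y)).
Proof.
have [->|/lead_exists[h lx]] := eqVneq x 0; first by rewrite add0r hval0 hadd0l.
have [->|/lead_exists[k ly]] := eqVneq y 0.
  by rewrite addr0 hval0 haddC hadd0l.
have [hk|hk] := pselect (hlt h k).
  by rewrite (lead_add lx ly hk).2; exact: hadd_lead hk.
have [kh|kh] := pselect (hlt k h).
  by rewrite addrC (lead_add ly lx kh).2 haddC; exact: hadd_lead kh.
have {}ly : lead y h by apply: heqv_lead ly; apply/heqvP.
have [[_ mx] [_ my]] := (lx, ly).
have add_h : hadd (hval x) (hval y) (lam (x h + y h) * u h)%hyper.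
  by rewrite (hvalE lx) (hvalE ly); exact/hadd_mulr/lamD.
have [xy0|xy0] := eqVneq ((x + y) h) 0; last first.
  rewrite (@hvalE (x + y) h); first exact: add_h.
  split=> // l lh; rewrite hahnDE.
  by rewrite mx // my // addr0.
rewrite -hahnDE xy0 lam0 hmul0l in add_h.
have [->|/lead_exists[l lxy]] := eqVneq (x + y) 0; first by rewrite hval0.
(* The leading terms cancel, so [y] has the value opposite to that of [x]. What survives in [x + y]
   lies strictly beyond [h], is absorbed by [x], and reversibility puts it into the hypersum. *)
rewrite (hopp_uniq add_h); apply: hadd_rev; rewrite haddC.
apply: (hadd_lead lx lxy).
have [//|hl] := pselect (hlt h l); have [/eqP xyl _] := lxy; case: xyl.
have [lh|lh] := pselect (hlt l h).
  by rewrite hahnDE mx // my // addr0.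
by apply: hahn_eqv0 xy0; apply/heqvP.
Qed.

Lemma hvalN x : hval (- x) = hopp (hval x).
Proof. by apply: hopp_uniq; rewrite -hval0 -(subrr x); exact: hvalD. Qed.

(* If one of the three hypersums relating [r], [s], [t] is a singleton then
   arbitrary lifts of the other two elements do; otherwise r = s = t = -r. *)
Lemma hval_hadd r s t : hadd r s t ->
  exists x y, [/\ hval x = r, hval y = s & hval (x + y) = t].
Proof.
move=> rst; have [x xr] := hval_ex r; have [y ys] := hval_ex s.
have [z zt] := hval_ex t.
have [rs|rs] := pselect (r = hopp s); last first.
  exists x, y; split=> //; apply: (hadd_single hR rs) => //.
  by rewrite -xr -ys; exact: hvalD.
have [ts|ts] := pselect (t = s); last first.
  exists (z - y), y; split; rewrite ?subrK //.
  have tNs : t <> hopp (hopp s) by rewrite hoppK.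
  apply: (hadd_single hR tNs) (hadd_rev rst).
  by rewrite -[t]zt -[s]ys -hvalN; exact: hvalD.
have [tr|tr] := pselect (t = r); last first.
  exists x, (z - x); split; rewrite ?subrKC //.
  have tNr : t <> hopp (hopp r) by rewrite hoppK.
  have srt : hadd s r t by rewrite haddC.
  apply: (hadd_single hR tNr) (hadd_rev srt).
  by rewrite -[t]zt -[r]xr -hvalN; exact: hvalD.
move: rst; rewrite -tr -ts => ttt.
have [t0|/u_surj[h uh]] := pselect (t = 0%hyper).
  by exists 0, 0; rewrite addr0 hval0 t0.
have [v [_ vt]] := hmul_ex (@u_neq0 h); rewrite uh in vt.
have [|p [q [lp lq lpq]]] := lam_idem.
  apply/hSP; by have := hadd_mull v ttt; rewrite vt.
exists (hahn_single p h), (hahn_single q h).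
by rewrite hahn_singleD !hval_single lp lq lpq hmul1l.
Qed.

Definition hval_one : set (hahn D) := [set x | hval x = 1%hyper].

Lemma hval_neq0 x : hval x <> 0%hyper -> x \is a GRing.unit.
Proof.
by move=> vx; apply: hahn_field; apply/eqP => x0; apply: vx; rewrite x0 hval0.
Qed.

Lemma hval_one_normal : is_normal_unit_subgroup hval_one.
Proof.
have unit1 x : hval_one x -> x \is a GRing.unit.
  by move=> vx; apply: hval_neq0; rewrite vx; exact: hone_neq0.
split=> //.
- exact: hval1.
- by move=> x y; rewrite /hval_one /= hvalM => -> ->; rewrite hmul1l.
- move=> x vx; rewrite /hval_one /= -[LHS]hmul1l -{1}vx -hvalM.
  by rewrite divrr ?hval1 //; exact: unit1.
- move=> g x gu; rewrite /hval_one /= !hvalM => ->.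
  by rewrite hmul1r -hvalM divrr ?hval1.
Qed.

Lemma realization_quotient : exists (K : unitRingType) (HK : is_skew_field K)
    (U : set K) (HU : is_normal_unit_subgroup U),
  isomorphic R (quotient_skewHyperfield HK HU).
Proof.
have HK : is_skew_field (hahn D) := @hahn_field D.
have HU := hval_one_normal.
exists (hahn D), HK, hval_one, HU.
have [pre preK] := choice hval_ex.
have classP x y : qclass hval_one x = qclass hval_one y <-> hval x = hval y.
  rewrite (qclassP HU); split=> [[w vw ->]|vxy].
    by rewrite hvalM vw hmul1r.
  have [y0|y0] := eqVneq y 0.
    exists 1; first exact: hval1.
    by rewrite y0 hval0 in vxy; rewrite y0 mul0r (hval_eq0 vxy).
  have yu := hahn_field y0.
  exists (y^-1 * x); last by rewrite mulrA divrr // mul1r.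
  by rewrite /hval_one /= hvalM vxy -hvalM mulVr // hval1.
exists (fun r => qclass hval_one (pre r)); split.
- exists (fun A => hval (qrepr A)) => [r|A].
    by rewrite -[RHS]preK; apply/classP/qreprK.
  by rewrite -[RHS]qreprK; apply/classP; exact: preK.
- by apply/classP; rewrite preK hval0.
- by apply/classP; rewrite preK hval1.
- by move=> r s; rewrite /= (qmulE HK HU); apply/classP; rewrite hvalM !preK.
move=> r s; rewrite /=; apply/seteqP; split=> A.
  move=> [t rst <-]; have [x [y [xr ys xyt]]] := hval_hadd rst.
  have /(qclassP HU)[v vv xE] : qclass hval_one x = qclass hval_one (pre r).
    by apply/classP; rewrite preK.
  have /(qclassP HU)[w vw yE] : qclass hval_one y = qclass hval_one (pre s).
    by apply/classP; rewrite preK.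
  have -> : qclass hval_one (pre t) = qclass hval_one (x + y).
    by apply/classP; rewrite preK.
  by apply/(qaddE HU); exists v, w; rewrite -xE -yE.
rewrite -(qreprK A) => /(qaddE HU)[v [w [vv vw ->]]].
exists (hval (pre r * v + pre s * w)); last by apply/classP; rewrite preK.
have := hvalD (pre r * v) (pre s * w).
by rewrite !hvalM vv vw !hmul1r !preK.
Qed.

End Realization.

(** * The group of nonzero elements and the case where 1 lies in 1 - 1 *)

Record hunits (R : skewHyperfield) :=
  HUnit { hunits_val :> R; hunits_neq0 : hunits_val <> 0%hyper }.

HB.instance Definition _ (R : skewHyperfield) := gen_eqMixin (hunits R).
HB.instance Definition _ (R : skewHyperfield) := gen_choiceMixin (hunits R).

Section UnitGroup.
Variable R : skewHyperfield.
Implicit Types a b c : hunits R.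
Local Open Scope hyper_scope.

Lemma hunits_inj : injective (@hunits_val R).
Proof.
move=> [a a0] [b b0] /= ab; subst b; congr HUnit; exact: Prop_irrelevance.
Qed.

Definition hunits_mul a b :=
  HUnit (hmul_neq0 (@hunits_neq0 _ a) (@hunits_neq0 _ b)).
Definition hunits_one := HUnit (@hone_neq0 R).

Lemma hunits_inv_ex a : exists b, hunits_val a * b = 1.
Proof.
have [y [ay ya]] := hmul_ex (@hunits_neq0 _ a).
suff y0 : y <> 0 by exists (HUnit y0).
by move=> y0; apply: (@hone_neq0 R); rewrite -ay y0 hmul0r.
Qed.

Definition hunits_inv a := projT1 (cid (hunits_inv_ex a)).

Lemma hunits_mulA : associative hunits_mul.
Proof. by move=> a b c; apply: hunits_inj; rewrite /= hmulA. Qed.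

Lemma hunits_mul1 : left_id hunits_one hunits_mul.
Proof. by move=> a; apply: hunits_inj; rewrite /= hmul1l. Qed.

Lemma hunits_mulr1 : right_id hunits_one hunits_mul.
Proof. by move=> a; apply: hunits_inj; rewrite /= hmul1r. Qed.

Lemma hunits_mulV : right_inverse hunits_one hunits_inv hunits_mul.
Proof. by move=> a; apply: hunits_inj; rewrite /= /hunits_inv; case: cid. Qed.

Lemma hunits_mulVl : left_inverse hunits_one hunits_inv hunits_mul.
Proof.
move=> a; apply: hunits_inj => /=; apply: hmul_inv_sym.
by have /(congr1 (@hunits_val R)) := hunits_mulV a.
Qed.

HB.instance Definition _ := isGroup.Build (hunits R)
  hunits_mulA hunits_mul1 hunits_mulr1 hunits_mulVl hunits_mulV.

Lemma hunitsM a b : hunits_val (a * b)%g = hunits_val a * hunits_val b.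
Proof. by []. Qed.

Lemma hunitsV a : hunits_val a * hunits_val a^-1%g = 1.
Proof. by rewrite -hunitsM mulgV. Qed.

Lemma hunitsVl a : hunits_val a^-1%g * hunits_val a = 1.
Proof. by rewrite -hunitsM mulVg. Qed.

Lemma hunits_surj (r : R) : r <> 0 -> exists a, hunits_val a = r.
Proof. by move=> r0; exists (HUnit r0). Qed.

Hypothesis hR : stringent R.

Definition hpos : set (hunits R) := [set a | small (hunits_val a)].

Lemma hpos_asym a : hpos a -> ~ hpos a^-1%g.
Proof. by move=> pa pV; apply: (small_inv hR pa pV); exact: hunitsV. Qed.

Lemma hposJ a b : hpos a -> hpos (b * a * b^-1)%g.
Proof. by move=> pa; apply: small_conj => //; exact: hunitsV. Qed.

Lemma hpos_mull a b : ~ hpos b^-1%g -> hpos a -> hpos (b * a)%g.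
Proof. exact: small_mull (hunitsV b). Qed.

Definition hunits_ord : preordered_group :=
  PreorderedGroup hpos_asym (@hposJ) hpos_mull.

Lemma hunitsN1 : exists2 n, @ker hunits_ord n & - 1 = hunits_val n.
Proof.
have N0 : (- 1 : R) <> 0.
  by move=> e; apply: (@hone_neq0 R); rewrite -[LHS]hoppK e hopp0.
exists (HUnit N0) => //.
have VE : ((HUnit N0)^-1)%g = HUnit N0.
  by apply: mulg1_eq; apply: hunits_inj; rewrite /= hmulN1l hoppK.
by split; rewrite ?VE => -[_ _ /=].
Qed.

End UnitGroup.

Section Signed.
Variable R : skewHyperfield.
Hypothesis hR : stringent R.
Hypothesis S1 : hS (1%hyper : R).
Implicit Types (a m n : hunits R).

(** Only the values on [ker], which is {1, -1}, matter; testing for 1 first also covers the case 1 =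
    -1. *)
Definition sgn_iota n : rat := if n == 1%g then 1 else -1.

Definition sgn_lam (p : rat) : R :=
  if p == 0 then 0%hyper else if 0 < p then 1%hyper else (- 1)%hyper.

Lemma sgn_ker n : @ker (hunits_ord hR) n ->
  n = 1%g \/ hunits_val n = (- 1)%hyper.
Proof.
move=> [pn pV]; have [n1|n1] := pselect (hunits_val n = 1%hyper).
  by left; apply: hunits_inj.
have [nN1|nN1] := pselect (hunits_val n = (- 1)%hyper); [by right|].
case: pV; apply: (small_inv_total hR S1 (hunitsV n)) => Sn.
by apply: pn.
Qed.

Lemma sgn_iotaM m n : @ker (hunits_ord hR) m -> @ker (hunits_ord hR) n ->
  sgn_iota (m * n)%g = sgn_iota m * sgn_iota n.
Proof.
move=> km kn; rewrite /sgn_iota.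
have [->|m1] := eqVneq m 1%g; first by rewrite !mul1g mul1r.
have [->|n1] := eqVneq n 1%g; first by rewrite mulg1 (negPf m1) mulr1.
have [/eqP|mE] := sgn_ker km; first by rewrite (negPf m1).
have [/eqP|nE] := sgn_ker kn; first by rewrite (negPf n1).
suff -> : (m * n)%g = 1%g by rewrite eqxx mulrNN mulr1.
by apply: hunits_inj; rewrite hunitsM mE nE hmulN1l hoppK.
Qed.

Lemma sgn_iotaJ a n : @ker (hunits_ord hR) n ->
  sgn_iota n = sgn_iota (a * n * a^-1)%g.
Proof.
move=> kn; suff -> : (a * n * a^-1 = n)%g by [].
have [->|nE] := sgn_ker kn; first by rewrite mulg1 mulgV.
by apply: hunits_inj; rewrite !hunitsM nE hmulN1r hmulNl hunitsV.
Qed.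

Lemma sgn_iota_neq0 n : sgn_iota n != 0.
Proof. by rewrite /sgn_iota; case: ifP => _; rewrite ?oppr_eq0 oner_eq0. Qed.

Lemma sgn_iota_act n (p : rat) : p = sgn_iota n * p * (sgn_iota n)^-1.
Proof. by rewrite mulrAC divff ?mul1r // sgn_iota_neq0. Qed.

Lemma sgn_iota1 : sgn_iota 1%g = 1. Proof. by rewrite /sgn_iota eqxx. Qed.

Lemma rat_field : GRing.field_axiom rat. Proof. by move=> p; rewrite unitfE. Qed.

(** The trivial action is compatible with [sgn_iota] because 1 and -1 are central and [rat] is
    commutative. *)
Definition sgn_system : crossed_system :=
  @CrossedSystem (hunits_ord hR) rat (fun _ p => p) sgn_iota rat_field
    (fun _ _ _ => erefl) (fun _ _ _ => erefl) (fun=> erefl)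
    (fun _ _ _ => erefl) (fun=> erefl)
    sgn_iota1 sgn_iotaM sgn_iotaJ (fun n p _ => sgn_iota_act n p).

Lemma sgn_lamM p q : sgn_lam (p * q) = (sgn_lam p * sgn_lam q)%hyper.
Proof.
rewrite /sgn_lam mulf_eq0; have [_|p0] /= := eqVneq p 0; first by rewrite hmul0l.
have [_|q0] /= := eqVneq q 0; first by rewrite hmul0r.
have [p_gt0|p_lt0|/eqP] := ltrgt0P p; last by rewrite (negPf p0).
  by rewrite pmulr_rgt0 // hmul1l.
rewrite nmulr_rgt0 //; have [q_gt0|q_lt0|/eqP] := ltrgt0P q.
- by rewrite hmul1r.
- by rewrite hmulN1l hoppK.
by rewrite (negPf q0).
Qed.

Lemma sgn_lamN p : sgn_lam (- p) = hopp (sgn_lam p).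
Proof.
rewrite /sgn_lam oppr_eq0 oppr_gt0; case: ltrgt0P => _ //; first by rewrite hoppK.
by rewrite hopp0.
Qed.

Lemma sgn_lam_gt0 p : 0 < p -> sgn_lam p = 1%hyper.
Proof. by move=> p0; rewrite /sgn_lam p0 gt_eqF. Qed.

Lemma sgn_lam0 : sgn_lam 0 = 0%hyper. Proof. by rewrite /sgn_lam eqxx. Qed.

Lemma sgn_lamD p q : hadd (sgn_lam p) (sgn_lam q) (sgn_lam (p + q)).
Proof.
have /hSP one2 := S1.
have SN1 : hS (- 1 : R)%hyper by have := haddNN S1; rewrite hoppK haddC.
have S0 : hS (0 : R)%hyper := haddN 1%hyper.
have pos p' q' : 0 < p' -> hadd (sgn_lam p') (sgn_lam q') (sgn_lam (p' + q')).
  move=> p0; rewrite (sgn_lam_gt0 p0).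
  have [q0|q0|->] := ltrgt0P q'.
  - by rewrite !sgn_lam_gt0 // addr_gt0.
  (* With opposite signs the sum can have any sign or be 0, and 1, -1 and 0 all lie in 1 - 1. *)
  - rewrite -[q']opprK sgn_lamN (@sgn_lam_gt0 (- q')) ?oppr_gt0 //.
    by rewrite /sgn_lam; case: ifP => // _; case: ifP.
  - by rewrite addr0 sgn_lam0 haddC hadd0l sgn_lam_gt0.
have [p0|p0|->] := ltrgt0P p; [exact: pos| |by rewrite add0r sgn_lam0 hadd0l].
rewrite -[p]opprK -[q]opprK -opprD.
rewrite (sgn_lamN (- p)) (sgn_lamN (- q)) (sgn_lamN (- p - q)); apply: haddNN.
by apply: pos; rewrite oppr_gt0.
Qed.

Lemma sgn_lam_ker p : p != 0 ->
  exists2 n, @ker sgn_system n & sgn_lam p = hunits_val n.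
Proof.
have k1 : @ker sgn_system (1%g : hunits R) := @ker1 sgn_system.
move=> p0; rewrite /sgn_lam (negPf p0); case: ifP => _; first by exists 1%g.
by have [n kn nE] := hunitsN1 hR; exists n.
Qed.

Lemma sgn_lam_iota n : @ker sgn_system n -> sgn_lam (sgn_iota n) = hunits_val n.
Proof.
move=> kn; rewrite /sgn_iota; have [-> //|n1] := eqVneq n 1%g.
have [/eqP|->] := sgn_ker kn; first by rewrite (negPf n1).
by rewrite sgn_lamN sgn_lam_gt0.
Qed.

Lemma signed_quotient : exists (K : unitRingType) (HK : is_skew_field K)
    (U : set K) (HU : is_normal_unit_subgroup U),
  isomorphic R (quotient_skewHyperfield HK HU).
Proof.
apply: (@realization_quotient R sgn_system (@hunits_val R) sgn_lam) => //.
- exact: hunits_neq0.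
- exact: hunits_surj.
- exact: sgn_lam_ker.
- exact: sgn_lamM.
- move=> a p; rewrite /sgn_lam /=; case: ifP => _; first by rewrite hmul0l hmul0r.
  by case: ifP; rewrite ?hmul1l ?hmul1r // hmulN1l hmulN1r.
- exact: sgn_lam_iota.
- exact: sgn_lamD.
by move=> _; exists 1, 1; rewrite !sgn_lam_gt0.
Qed.

End Signed.

(** * The case where 1 does not lie in 1 - 1 *)

(* When 1 is not in 1 - 1, the elements comparable with 1 together with 0 form
   a skew field: their hypersums contain exactly one such element. *)
Definition residual (R : skewHyperfield) (hR : stringent R) (r : R) :=
  r = 0%hyper \/ exists2 n, @ker (hunits_ord hR) n & r = hunits_val n.

(** The type carries [nS1] so that a ring structure relying on it can be attached as an instance. *)
Record residue (R : skewHyperfield) (hR : stringent R)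
    (nS1 : ~ hS (1%hyper : R)) :=
  Residue { residue_val :> R; residueP : residual hR residue_val }.

HB.instance Definition _ R hR nS1 := gen_eqMixin (@residue R hR nS1).
HB.instance Definition _ R hR nS1 := gen_choiceMixin (@residue R hR nS1).

Section Residue.
Variable R : skewHyperfield.
Hypothesis hR : stringent R.
Hypothesis nS1 : ~ hS (1%hyper : R).
Local Notation F := (residue hR nS1).
Local Notation ker := (@ker (hunits_ord hR)).
Local Notation residual := (residual hR).
Implicit Types (p q r c v w : R) (n m : hunits R) (x y z : F).
Local Open Scope hyper_scope.

Lemma residue_inj x y : residue_val x = residue_val y -> x = y.
Proof.
case: x y => [x px] [y py] /= xy; subst y; congr Residue.
exact: Prop_irrelevance.
Qed.

Lemma ker_absorb n c v : ker n -> small c -> hadd (hunits_val n) c v ->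
  v = hunits_val n.
Proof.
move=> [pn _] sc ncv; have := hadd_mull (hunits_val n^-1%g) ncv.
rewrite hunitsVl => /(small_add1 hR) nv.
rewrite -[v]hmul1l -(hunitsV n) -hmulA nv ?hmul1r //.
exact: (small_mull hR (hunitsVl n)).
Qed.

Lemma residual_small r : residual r -> small r -> r = 0.
Proof. by move=> [//|[n [pn _] ->]] /pn. Qed.

Lemma residual_mul p q : residual p -> residual q -> residual (p * q).
Proof.
move=> [->|[n kn ->]]; first by rewrite hmul0l; left.
move=> [->|[m km ->]]; first by rewrite hmul0r; left.
by right; exists (n * m)%g => //; exact: kerM.
Qed.

Lemma residual1 : residual 1.
Proof. by right; exists 1%g => //; exact: ker1. Qed.

Lemma residualN1 : residual (- 1).
Proof.
by have [n kn nE] := hunitsN1 hR; right; exists n.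
Qed.

Lemma residualN p : residual p -> residual (- p).
Proof. by rewrite -hmulN1l; apply: residual_mul; exact: residualN1. Qed.

(** For nonzero [p] and [q] with [p] not [- q], let [w] be in the sum. Were [w] negligible, [- q]
    would absorb it, giving [p = - q]; were its inverse negligible, dividing by [w] would make 1 a
    sum of two negligible elements. *)
Lemma residual_add_ex p q : residual p -> residual q ->
  exists2 r, residual r & hadd p q r.
Proof.
move=> rp rq; have [->|[n kn pE]] := rp; first by exists q; rewrite ?hadd0l.
have [->|[m km qE]] := rq; first by exists p; rewrite // haddC hadd0l.
have [pq|pq] := pselect (p = - q).
  by exists 0; [left | rewrite pq haddC; exact: haddN].
have [w pqw] := hadd_ex p q; exists w => //.
have w0 : w <> 0.
  by move=> w0; apply: pq; rewrite w0 haddC in pqw; exact: hopp_uniq.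
right; exists (HUnit w0) => //; split=> /= [sw|sw].
  apply: pq; have [q0|[m' km' qE']] := residualN rq.
    have : small q by rewrite -[q]hoppK q0 hopp0; exact: small0.
    by rewrite qE; case: km.
  have := hadd_rev pqw; rewrite haddC qE'; exact: ker_absorb.
apply: (@small1 R); set k := (HUnit w0)^-1%g in sw.
have kk l : ker l -> small (hunits_val k * hunits_val l).
  move=> [_ pl]; rewrite -hunitsM.
  exact: (@pos_mulr (hunits_ord hR) k l).
have := hadd_mull (hunits_val k) pqw; rewrite pE qE => /(small_add hR).
have -> : hunits_val k * w = 1 by exact: (hunitsVl (HUnit w0)).
by apply; exact: kk.
Qed.

Lemma residual_sub_small p c : residual p -> hadd p (- p) c -> small c.
Proof.
move=> [->|[n kn ->]]; first by rewrite hadd0l hopp0 => ->; exact: small0.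
move=> /(hadd_mull (hunits_val n^-1%g)); rewrite hmulNr hunitsVl => /hS_small.
move=> /(_ nS1) sc; rewrite -[c]hmul1l -(hunitsV n) -hmulA.
by apply: (small_mull hR (hunitsV n)) => //; case: kn.
Qed.

(** Only [p] - [p] can have several elements; all of them are negligible, so 0 is the only residual
    one. *)
Lemma residual_add_uniq p q r v : residual p -> residual r -> residual v ->
  hadd p q r -> hadd p q v -> r = v.
Proof.
move=> rp rr rv; have [pq|pq] := pselect (p = - q); last exact: hadd_single.
have {pq}-> : q = - p by rewrite pq hoppK.
move=> /(residual_sub_small rp)/(residual_small rr) ->.
by move=> /(residual_sub_small rp)/(residual_small rv) ->.
Qed.

Definition residue_add x y : F :=
  let e := cid2 (residual_add_ex (residueP x) (residueP y)) in
  Residue nS1 (s2valP e).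

Lemma residue_addP x y : hadd x y (residue_add x y).
Proof. by rewrite /residue_add /=; case: cid2. Qed.

Lemma residue_addE x y z : hadd x y z -> residue_add x y = z.
Proof.
move=> xyz; apply: residue_inj.
exact: (residual_add_uniq (residueP x) (residueP _) (residueP _)
  (residue_addP x y)).
Qed.

Definition residue_zero : F := Residue nS1 (or_introl erefl).
Definition residue_opp x : F := Residue nS1 (residualN (residueP x)).
Definition residue_mul x y : F :=
  Residue nS1 (residual_mul (residueP x) (residueP y)).
Definition residue_one : F := Residue nS1 residual1.

Lemma residue_addC : commutative residue_add.
Proof.
by move=> x y; apply: residue_addE; rewrite haddC; exact: residue_addP.
Qed.

Lemma residue_add0 : left_id residue_zero residue_add.
Proof. by move=> x; apply: residue_addE; rewrite hadd0l. Qed.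

Lemma residue_addN : left_inverse residue_zero residue_opp residue_add.
Proof. by move=> x; apply: residue_addE; rewrite haddC; exact: haddN. Qed.

(** Hyperassociativity passes through some [v] in [x] + [y] that may fail to be residual. This
    happens only for [x = - y]; then [v] is negligible and has no effect on the residual sum with
    [z]. *)
Lemma residue_addA : associative residue_add.
Proof.
move=> x y z; set s := residue_add x _.
have [v xyv vzs] : exists2 v : R, hadd x y v & hadd v z s.
  exact: haddAr (residue_addP y z) (residue_addP x _).
apply/esym; have [xy|xy] := pselect ((x : R) = - y); last first.
  apply: residue_addE; rewrite -(hadd_single hR xy xyv (residue_addP x y)).
  exact: vzs.
have sv : small v.
  by apply: (residual_sub_small (residueP x)); rewrite {2}xy hoppK.
have -> : residue_add x y = residue_zero.
  by apply: residue_addE; rewrite xy haddC; exact: haddN.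
rewrite residue_add0; apply: residue_inj.
have [z0|[n kn zE]] := residueP z; last first.
  by apply/esym; rewrite zE; apply: (ker_absorb kn sv); rewrite haddC -zE.
move: vzs; rewrite z0 haddC hadd0l => sE.
by apply/esym/(residual_small (residueP s)); rewrite sE.
Qed.

HB.instance Definition _ := GRing.isZmodule.Build F
  residue_addA residue_addC residue_add0 residue_addN.

Lemma residue_mulA : associative residue_mul.
Proof. by move=> x y z; apply: residue_inj; rewrite /= hmulA. Qed.

Lemma residue_mul1l : left_id residue_one residue_mul.
Proof. by move=> x; apply: residue_inj; rewrite /= hmul1l. Qed.

Lemma residue_mul1r : right_id residue_one residue_mul.
Proof. by move=> x; apply: residue_inj; rewrite /= hmul1r. Qed.

Lemma residue_mulDl : left_distributive residue_mul residue_add.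
Proof.
by move=> x y z; apply/esym/residue_addE/hadd_mulr; exact: residue_addP.
Qed.

Lemma residue_mulDr : right_distributive residue_mul residue_add.
Proof.
by move=> x y z; apply/esym/residue_addE/hadd_mull; exact: residue_addP.
Qed.

Lemma residue_one_neq0 : residue_one != residue_zero.
Proof. by apply/eqP => /(congr1 (@residue_val _ _ _)); exact: hone_neq0. Qed.

HB.instance Definition _ := GRing.Zmodule_isNzRing.Build F
  residue_mulA residue_mul1l residue_mul1r residue_mulDl residue_mulDr
  residue_one_neq0.

Lemma residue_right_inverse x : (x != 0)%R -> exists y : F, (x * y = 1)%R.
Proof.
move=> /eqP x0; have [x1|[n kn xE]] := residueP x.
  by case: x0; exact: residue_inj.
have rn : residual (hunits_val n^-1%g) by right; exists n^-1%g => //; exact: kerV.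
by exists (Residue nS1 rn); apply: residue_inj; rewrite /= xE; exact: hunitsV.
Qed.

HB.instance Definition _ : GRing.NzRing_hasMulInverse F :=
  division_ring_mixin residue_right_inverse.

Lemma residue_field : GRing.field_axiom F. Proof. by []. Qed.

Lemma residual_conj (a : hunits R) p : residual p ->
  residual (hunits_val a * p * hunits_val a^-1%g).
Proof.
move=> [->|[n kn ->]]; first by left; rewrite hmul0r hmul0l.
by right; exists (a * n * a^-1)%g => //; exact: kerJ.
Qed.

Definition residue_act (a : hunits R) x : F :=
  Residue nS1 (residual_conj a (residueP x)).

Definition residue_iota n : F :=
  if pselect (ker n) is left kn
  then Residue nS1 (or_intror (ex_intro2 _ _ n kn erefl)) else 0%R.

Lemma residue_iotaE n : ker n -> residue_val (residue_iota n) = hunits_val n.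
Proof. by rewrite /residue_iota; case: pselect. Qed.

Lemma residue_actD a x y :
  (residue_act a (x + y) = residue_act a x + residue_act a y)%R.
Proof.
apply/esym/residue_addE/hadd_mulr/hadd_mull; exact: residue_addP.
Qed.

Lemma residue_actM a x y :
  (residue_act a (x * y) = residue_act a x * residue_act a y)%R.
Proof.
apply: residue_inj; rewrite /= !hmulA; congr (_ * _ * _).
by rewrite -[in RHS](hmulA _ (hunits_val a^-1%g)) hunitsVl hmul1r.
Qed.

Lemma residue_act1 a : residue_act a 1%R = 1%R.
Proof. by apply: residue_inj; rewrite /= hmul1r hunitsV. Qed.

Lemma residue_act_mul a b x :
  residue_act (a * b)%g x = residue_act a (residue_act b x).
Proof. by apply: residue_inj; rewrite /= invgM !hunitsM !hmulA. Qed.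

Lemma residue_act_one x : residue_act 1%g x = x.
Proof. by apply: residue_inj; rewrite /= invg1 /= hmul1l hmul1r. Qed.

Lemma residue_iota1 : residue_iota 1%g = 1%R.
Proof. by apply: residue_inj; rewrite residue_iotaE //; exact: ker1. Qed.

Lemma residue_iotaM m n : ker m -> ker n ->
  residue_iota (m * n)%g = (residue_iota m * residue_iota n)%R.
Proof.
move=> km kn; apply: residue_inj; rewrite /= !residue_iotaE //.
exact: kerM.
Qed.

Lemma residue_act_iota a n : ker n ->
  residue_act a (residue_iota n) = residue_iota (a * n * a^-1)%g.
Proof.
move=> kn; apply: residue_inj; rewrite /= !residue_iotaE //.
exact: kerJ.
Qed.

Lemma residue_iota_act n x : ker n ->
  residue_act n x = (residue_iota n * x * (residue_iota n)^-1)%R.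
Proof.
move=> kn; have kV := kerV kn.
have iV : (residue_iota n * residue_iota n^-1%g = 1)%R.
  by rewrite -residue_iotaM // mulgV residue_iota1.
have iu : residue_iota n \is a GRing.unit.
  apply: residue_field; apply/eqP => i0; move/eqP: iV.
  by rewrite i0 mul0r eq_sym oner_eq0.
have -> : ((residue_iota n)^-1 = residue_iota n^-1%g)%R.
  by apply: (mulrI iu); rewrite iV divrr.
by apply: residue_inj; rewrite /= !residue_iotaE.
Qed.

Definition residue_system : crossed_system :=
  @CrossedSystem (hunits_ord hR) F residue_act residue_iota residue_field
    residue_actD residue_actM residue_act1 residue_act_mul residue_act_one
    residue_iota1 residue_iotaM residue_act_iota residue_iota_act.

Lemma residue_quotient : exists (K : unitRingType) (HK : is_skew_field K)
    (U : set K) (HU : is_normal_unit_subgroup U),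
  isomorphic R (quotient_skewHyperfield HK HU).
Proof.
(* The condition [lam_idem] holds vacuously here, by [nS1]. *)
apply: (@realization_quotient R residue_system (@hunits_val R)
  (@residue_val _ hR nS1)) => //.
- exact: hunits_neq0.
- exact: hunits_surj.
- move=> x x0; have [x1|//] := residueP x.
  by move/eqP: x0; case; exact: residue_inj.
- by move=> a x /=; rewrite -hmulA hunitsVl hmul1r.
- exact: residue_iotaE.
- exact: residue_addP.
Qed.

End Residue.

Theorem theorem7p5 (F : skewHyperfield) (hF : stringent F) :
  exists (K : unitRingType) (HK : is_skew_field K)
         (U : set K) (HU : is_normal_unit_subgroup U),
    isomorphic F (quotient_skewHyperfield HK HU).
Proof.
have [S1|nS1] := pselect (hS (1%hyper : F)); first exact: signed_quotient.
exact: (residue_quotient hF nS1).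
Qed.
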